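(* Let $(\Omega,T)$ be a minimal subshift over a finite alphabet. The language $L(\Omega)$ is recursive if and only if the commutator subgroup $G_T'$ of the topological full group has solvable word problem.
   Context: $T$ is the left shift $(T\omega)_m=\omega_{m+1}$ on $A^{\mathbb Z}$, $A$ finite; a minimal subshift is a closed shift-invariant $\Omega\subseteq A^{\mathbb Z}$ with every orbit dense. $L(\Omega)$ is the set of all finite words occurring in sequences of $\Omega$; it is recursive if membership in it is algorithmically decidable. $G_T$ is the group of homeomorphisms $S$ of $\Omega$ with $S(x)=T^{f_S(x)}x$ for a continuous $f_S:\Omega\to\mathbb Z$, and $G_T'$ is its commutator subgroup, which is finitely generated (solvability of the word problem does not depend on the choice of finite generating set). *)

(* Defs.v *)
From HB Require Import structures.
From mathcomp Require Import all_boot all_order all_algebra.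
Set Implicit Arguments. Unset Strict Implicit. Unset Printing Implicit Defensive.
Import Order.TTheory GRing.Theory Num.Theory.

Inductive prf : Type :=
| PZero : prf
| PSucc : prf
| PProj : nat -> prf
| PComp : prf -> seq prf -> prf
| PRec  : prf -> prf -> prf
| PMin  : prf -> prf.

Inductive peval : prf -> seq nat -> nat -> Prop :=
| ev_zero v : peval PZero v 0
| ev_succ v : peval PSucc v (head 0 v).+1
| ev_proj i v : peval (PProj i) v (nth 0 v i)
| ev_comp f gs v ws r :
    pevals gs v ws -> peval f ws r -> peval (PComp f gs) v r
| ev_rec0 f g v r : peval f v r -> peval (PRec f g) (0 :: v) r
| ev_recS f g n v r r' :
    peval (PRec f g) (n :: v) r -> peval g (n :: r :: v) r' ->
    peval (PRec f g) (n.+1 :: v) r'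
| ev_min f v n :
    peval f (n :: v) 0 ->
    (forall m, (m < n)%N -> exists k, peval f (m :: v) k.+1) ->
    peval (PMin f) v n
with pevals : seq prf -> seq nat -> seq nat -> Prop :=
| evs_nil v : pevals [::] v [::]
| evs_cons g gs v w ws :
    peval g v w -> pevals gs v ws -> pevals (g :: gs) v (w :: ws).

(* A predicate on a countable type is recursive (decidable) if some
   mu-recursive program computes its characteristic function on the
   standard (computable) code [pickle t] of t. *)
Definition recursive (T : countType) (P : T -> Prop) : Prop :=
  exists p : prf, forall t : T,
    (P t -> peval p [:: pickle t] 1) /\ (~ P t -> peval p [:: pickle t] 0).

Local Open Scope ring_scope.

Section Dyn.
Variable A : finType.
Notation X := (int -> A).

Definition shiftn (k : int) (x : X) : X := fun m => x (m + k).
Definition shiftT (x : X) : X := shiftn 1 x.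

(* x and y agree on the window [-n, n]; these windows give the basic
   neighbourhoods of the product topology on A^Z *)
Definition agree (n : nat) (x y : X) : Prop :=
  forall m : int, (absz m <= n)%N -> x m = y m.

Definition closed_set (Om : X -> Prop) : Prop :=
  forall x, (forall n, exists2 y, Om y & agree n x y) -> Om x.

Definition shift_invariant (Om : X -> Prop) : Prop :=
  forall x, Om x <-> Om (shiftT x).

Definition minimal_subshift (Om : X -> Prop) : Prop :=
  [/\ exists x, Om x, closed_set Om, shift_invariant Om &
      forall x y, Om x -> Om y -> forall n, exists k : int, agree n (shiftn k x) y].

Definition occurs (w : seq A) (x : X) : Prop :=
  exists i : int, w = [seq x (i + (j%:Z)) | j <- iota 0 (size w)].

Definition language (Om : X -> Prop) (w : seq A) : Prop :=
  exists2 x, Om x & occurs w x.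

Definition cont_on (Om : X -> Prop) (F : X -> X) : Prop :=
  forall x, Om x -> forall n, exists m,
    forall y, Om y -> agree m x y -> agree n (F x) (F y).

Definition cont_int_on (Om : X -> Prop) (f : X -> int) : Prop :=
  forall x, Om x -> exists m, forall y, Om y -> agree m x y -> f y = f x.

Definition maps_into (Om : X -> Prop) (F : X -> X) : Prop :=
  forall x, Om x -> Om (F x).

Definition inverse_on (Om : X -> Prop) (F G : X -> X) : Prop :=
  (forall x, Om x -> G (F x) = x) /\ (forall x, Om x -> F (G x) = x).

Definition homeo_on (Om : X -> Prop) (F : X -> X) : Prop :=
  [/\ maps_into Om F, cont_on Om F &
      exists G, [/\ maps_into Om G, cont_on Om G & inverse_on Om F G]].

(* topological full group G_T: homeomorphisms S of Om with
   S x = T^(f x) x for a continuous f : Om -> Z.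
   Elements are maps X -> X, considered up to equality on Om. *)
Definition in_GT (Om : X -> Prop) (S : X -> X) : Prop :=
  homeo_on Om S /\
  exists f : X -> int, cont_int_on Om f /\
    forall x, Om x -> S x = shiftn (f x) x.

Definition is_commutator (Om : X -> Prop) (C : X -> X) : Prop :=
  exists g gi h hi, [/\ in_GT Om g, in_GT Om h,
    inverse_on Om g gi, inverse_on Om h hi &
    forall x, Om x -> C x = gi (hi (g (h x)))].

Definition compose_all (s : seq (X -> X)) : X -> X :=
  foldr (fun f acc => fun x => f (acc x)) id s.

(* the commutator subgroup G_T': finite products of commutators
   (inverses of commutators are commutators) *)
Definition in_GT' (Om : X -> Prop) (F : X -> X) : Prop :=
  exists s : seq (X -> X), (forall i, (i < size s)%N -> is_commutator Om (nth id s i)) /\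
    forall x, Om x -> F x = compose_all s x.

(* words in a finite generating family S = [(s_1, s_1^-1); ...]:
   letter (i, false) stands for s_i, letter (i, true) for s_i^-1 *)
Definition eval_word (S : seq ((X -> X) * (X -> X)))
  (w : seq ('I_(size S) * bool)) : X -> X :=
  compose_all [seq (if l.2 then (nth (id, id) S (val l.1)).2 else (nth (id, id) S (val l.1)).1)
              | l : 'I_(size S) * bool <- w].

Definition gen_set_GT' (Om : X -> Prop) (S : seq ((X -> X) * (X -> X))) : Prop :=
  (forall i, (i < size S)%N ->
     in_GT' Om (nth (id, id) S i).1 /\ inverse_on Om (nth (id, id) S i).1 (nth (id, id) S i).2) /\
  (forall F, in_GT' Om F ->
     exists w : seq ('I_(size S) * bool), forall x, Om x -> F x = eval_word w x).

(* G_T' has solvable word problem: for a finite generating set, the set of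
   words representing the identity is recursive (independent of the choice) *)
Definition GT'_solvable_WP (Om : X -> Prop) : Prop :=
  exists S : seq ((X -> X) * (X -> X)), gen_set_GT' Om S /\
    recursive (fun w : seq ('I_(size S) * bool) =>
                 forall x, Om x -> eval_word w x = x).
End Dyn.

(* Main.v *)
Require Import Defs.
From mathcomp Require Import all_boot all_order all_algebra.
From mathcomp Require Import fingroup perm boolp zify.
Set Implicit Arguments. Unset Strict Implicit. Unset Printing Implicit Defensive.

(** If [T] has a periodic point then [Om] is a finite orbit and both sides hold.
Otherwise let [gam U] be the 3-cycle [U -> TU -> T^2 U -> U], for [U] clopen with
[U], [TU], [T^2 U] disjoint.

Every element of the derived group is a product of such 3-cycles. Let [alt] be the
group they generate; it is normal and contains all even permutations of the levels
of towers. Given a clopen marker set [U] with bounded gaps, composing [g] with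
3-cycles fixes the points of each block between markers one after the other, so [g]
is congruent modulo [alt] to an element supported near [U]. Doing this for [g] with
[U] and for [h] with a translate of [U] makes the supports disjoint, hence [g] and
[h] commute modulo [alt].

If [W] has five disjoint levels and [U], [V] are subsets of [W] and [T^2 W], then the
commutator of [gam U] and [gam V] is the 3-cycle over the intersection of [TU] and
[T^-1 V]. So the 3-cycles over long cylinders are obtained from those over finitely
many short ones, which gives finite generation; and since the passage from a word to
its one-letter extension is a recursion on words of the group, a word [w] is in the
language iff a computable word of the group, representing the 3-cycle over the
cylinder of [w], is nontrivial. Conversely a word of the group is decided by letting
it act on all words of the language that are long enough. *)

(** * Recursive functions on codes of words *)

(** Recursiveness refers to concrete programs acting on numbers, so every algorithm below is an
    arithmetic function of codes. Each one-letter extension uses the previous group word three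
    times, so lengths grow exponentially; the code of the new word is computed by arithmetic alone,
    because the code of a concatenation is affine in the code of its second part. Words and
    displacements obtained by choice concern finitely many arguments only and enter as finite
    tables.

    Five levels are required because the cycles [0 -> 1 -> 2 -> 0] and [2 -> 3 -> 4 -> 2] share
    exactly one point, and the commutator of two such cycles is again a 3-cycle.

    Inside a block the sorting cannot reach everything: a 3-cycle that corrects one level spoils a
    third one, for which the two lowest levels are given up, and points close to an end of the block
    may cross into the neighbouring one. What remains unsorted stays at bounded distance from the
    markers, with a bound independent of the spacing of the markers. Hence the markers can be chosen
    sparse enough for a translate of them to be far from them. *)

Definition compk (k : nat) (F : seq nat -> nat) : Prop :=
  exists p, forall v, size v = k -> peval p v (F v).

Lemma compk_ext k F G : (forall v, size v = k -> F v = G v) ->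
  compk k F -> compk k G.
Proof. by move=> E [p Hp]; exists p => v Hv; rewrite -E //; apply: Hp. Qed.

Lemma compk_comp k m (F : seq nat -> nat) (Gs : seq (seq nat -> nat)) :
  size Gs = m -> compk m F -> (forall i, i < m -> compk k (nth (fun=> 0) Gs i)) ->
  compk k (fun v => F [seq G v | G <- Gs]).
Proof.
move=> sG [p Hp] H.
have [ps Hps] : exists ps, forall v, size v = k ->
    pevals ps v [seq G v | G <- Gs].
  elim: Gs m sG {p Hp} H => [|G Gs IH] [//|m] /= sG H.
    by exists [::] => v _; constructor.
    by [].
  have [q Hq] := H 0 erefl.
  have [|qs Hqs] := IH m _ (fun i Hi => H i.+1 Hi); first by case: sG.
  by exists (q :: qs) => v Hv; constructor; [apply: Hq | apply: Hqs].
exists (PComp p ps) => v Hv; apply: ev_comp (Hps _ Hv) _.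
by apply: Hp; rewrite size_map.
Qed.

Lemma compk_proj k i : compk k (fun v => nth 0 v i).
Proof. by exists (PProj i) => v _; constructor. Qed.

Lemma compk0 k : compk k (fun=> 0).
Proof. by exists PZero => v _; constructor. Qed.

Lemma compk_comp1 k (f : nat -> nat) F :
  compk 1 (fun v => f (nth 0 v 0)) -> compk k F -> compk k (fun v => f (F v)).
Proof.
move=> Hf HF.
apply: (@compk_comp k 1 (fun v => f (nth 0 v 0)) [:: F]) => //.
by case.
Qed.

Lemma compk_comp2 k (f : nat -> nat -> nat) F G :
  compk 2 (fun v => f (nth 0 v 0) (nth 0 v 1)) -> compk k F -> compk k G ->
  compk k (fun v => f (F v) (G v)).
Proof.
move=> Hf HF HG.
apply: (@compk_comp k 2 (fun v => f (nth 0 v 0) (nth 0 v 1)) [:: F; G]) => //.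
by case=> [|[]].
Qed.

Lemma compk_comp3 k (f : nat -> nat -> nat -> nat) F G H :
  compk 3 (fun v => f (nth 0 v 0) (nth 0 v 1) (nth 0 v 2)) ->
  compk k F -> compk k G -> compk k H ->
  compk k (fun v => f (F v) (G v) (H v)).
Proof.
move=> Hf HF HG HH.
apply: (@compk_comp k 3 (fun v => f (nth 0 v 0) (nth 0 v 1) (nth 0 v 2))
  [:: F; G; H]) => //.
by case=> [|[|[]]].
Qed.

Lemma compkS k F : compk k F -> compk k (fun v => (F v).+1).
Proof.
apply: compk_comp1; exists PSucc => v _.
by rewrite nth0; constructor.
Qed.

Lemma compk_const k n : compk k (fun=> n).
Proof. by elim: n => [|n IH]; [apply: compk0 | apply: compkS]. Qed.

Lemma compk_rec k (N F : seq nat -> nat) (G : nat -> nat -> seq nat -> nat) :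
  compk k N -> compk k F ->
  compk k.+2 (fun v => G (nth 0 v 0) (nth 0 v 1) (drop 2 v)) ->
  compk k (fun v => nat_rect _ (F v) (fun n r => G n r v) (N v)).
Proof.
move=> HN [pF HF] [pG HG].
pose R (v : seq nat) :=
  nat_rect (fun=> nat) (F (behead v)) (fun n r => G n r (behead v)) (head 0 v).
have cR : compk k.+1 R.
  exists (PRec pF pG) => [[//|n v]] /= [sv]; rewrite /R /=.
  elim: n => [|n IH] /=; first by constructor; apply: HF.
  apply: (ev_recS IH).
  have := HG [:: n, nat_rect (fun=> nat) (F v) (fun n r => G n r v) n & v].
  by rewrite /= drop0; apply; rewrite sv.
(* [PRec] counts on the head of its argument, so the count [N v] is put in front of a copy of [v]
   made of projections. *)
pose Gs := N :: [seq (fun v : seq nat => nth 0 v i) | i <- iota 0 k].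
apply: compk_ext (@compk_comp k k.+1 R Gs _ cR _).
- move=> v sv; rewrite /Gs /R /=; set u := map _ _.
  suff -> : u = v by [].
  apply: (@eq_from_nth _ 0); first by rewrite !size_map size_iota sv.
  rewrite !size_map size_iota => i Hi.
  rewrite (nth_map (fun=> 0)) ?size_map ?size_iota // (nth_map 0) ?size_iota //.
  by rewrite nth_iota.
- by rewrite /= size_map size_iota.
case=> [//|i] Hi /=; rewrite (nth_map 0) ?size_iota //.
exact: compk_proj.
Qed.

Lemma compkD k F G : compk k F -> compk k G -> compk k (fun v => F v + G v).
Proof.
apply: compk_comp2.
apply: compk_ext (compk_rec (G := fun _ r _ => r.+1) (compk_proj 2 0)
  (compk_proj 2 1) (compkS (compk_proj 4 1))).
by move=> v _ /=; elim: (nth 0 v 0) => //= n ->.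
Qed.

Lemma compkM k F G : compk k F -> compk k G -> compk k (fun v => F v * G v).
Proof.
apply: compk_comp2.
apply: compk_ext (compk_rec (G := fun _ r v => r + nth 0 v 1) (compk_proj 2 0)
  (compk0 2) (compkD (compk_proj 4 1) _)).
  by move=> v _ /=; elim: (nth 0 v 0) => //= n ->; rewrite mulSn addnC.
by apply: compk_ext (compk_proj 4 3) => v _; rewrite nth_drop.
Qed.

Lemma compk_pred k F : compk k F -> compk k (fun v => (F v).-1).
Proof.
apply: compk_comp1.
apply: compk_ext (compk_rec (G := fun n _ _ => n) (compk_proj 1 0)
  (compk0 1) (compk_proj 3 0)).
by move=> v _ /=; case: (nth 0 v 0).
Qed.

Lemma compkB k F G : compk k F -> compk k G -> compk k (fun v => F v - G v).
Proof.
apply: compk_comp2.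
apply: compk_ext (compk_rec (G := fun _ r _ => r.-1) (compk_proj 2 1)
  (compk_proj 2 0) (compk_pred (compk_proj 4 1))).
by move=> v _ /=; elim: (nth 0 v 1) => [|n /= ->] /=; lia.
Qed.

Lemma compk_exp2 k F : compk k F -> compk k (fun v => 2 ^ F v).
Proof.
apply: compk_comp1.
apply: compk_ext (compk_rec (G := fun _ r _ => r + r) (compk_proj 1 0)
  (compk_const 1 1) (compkD (compk_proj 3 1) (compk_proj 3 1))).
by move=> v _ /=; elim: (nth 0 v 0) => [|n /= ->] //; rewrite expnS; lia.
Qed.

Lemma compk_if k F G H : compk k F -> compk k G -> compk k H ->
  compk k (fun v => if F v == 0 then G v else H v).
Proof.
move=> HF HG HH.
apply: compk_ext (compkD (compkM (compkB (compk_const k 1) HF) HG)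
  (compkM (compkB (compk_const k 1) (compkB (compk_const k 1) HF)) HH)).
by move=> v _; case: (F v) => [|n] /=; rewrite ?subn0 ?subnn ?mul0n ?mul1n ?addn0 ?subSS ?sub0n.
Qed.

Lemma compk_eq k F G : compk k F -> compk k G ->
  compk k (fun v => (F v == G v : nat)).
Proof.
move=> HF HG.
apply: compk_ext (compkB (compk_const k 1) (compkD (compkB HF HG) (compkB HG HF))).
by move=> v _; case: eqP; lia.
Qed.

(** Finitely many values can be hard-wired into a program, however they were obtained. All data that
    come from choice enter the algorithms in this way. *)
Lemma compk_table k (t : nat -> nat) B F : (forall z, B <= z -> t z = t B) ->
  compk k F -> compk k (fun v => t (F v)).
Proof.
move=> HB; apply: compk_comp1.
elim: B t HB => [|B IH] t HB.
  apply: compk_ext (compk_const 1 (t 0)) => v _; by rewrite [RHS]HB.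
have IH' := IH (fun z => t z.+1) (fun z Hz => HB z.+1 Hz).
apply: compk_ext (compk_if (compk_proj 1 0) (compk_const 1 (t 0))
  (compk_comp1 (f := fun z => t z.+1) IH' (compk_pred (compk_proj 1 0)))).
by move=> v _ /=; case: (nth 0 v 0) => [|z].
Qed.

(** * Arithmetic of the coding of sequences by numbers *)

Section Codes.
Local Notation code := CodeSeq.code.
Local Notation decode := CodeSeq.decode.

Lemma code_cons n s : code (n :: s) = 2 ^ n * (code s).*2.+1.
Proof. by []. Qed.

(** Makes the code itself a sufficient number of iterations for a loop along the word. *)
Lemma size_le_code s : size s <= code s.
Proof.
elim: s => //= n s IH.
have : 0 < 2 ^ n by rewrite expn_gt0.
rewrite /= -muln2; nia.
Qed.

(** Turns a quantifier over all words of a given length over a finite alphabet into a bounded one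
    over numbers. *)
Lemma code_lt B s : all (fun n => n <= B) s -> code s < 2 ^ (B.+1 * size s).
Proof.
elim: s => [|n s IH]; first by rewrite muln0.
case/andP => Hn /IH; rewrite code_cons.
have -> : B.+1 * size (n :: s) = B.+1 + B.+1 * size s by rewrite /= mulnS.
rewrite expnD [2 ^ B.+1]expnS; set c := 2 ^ (_ * _).
have Hab : 2 ^ n <= 2 ^ B by rewrite leq_exp2l.
have Hb : 0 < 2 ^ B by rewrite expn_gt0.
rewrite -muln2 => Hc; apply: (@leq_ltn_trans (2 ^ B * (code s * 2).+1)); last 1 first.
  rewrite -mulnA [2 * _]mulnCA ltn_mul2l Hb /=; lia.
by rewrite leq_mul2r Hab orbT.
Qed.

Definition hdc c := head 0 (decode c).
Definition dropc i c := code (drop i (decode c)).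

Lemma hdc_code s : hdc (code s) = head 0 s.
Proof. by rewrite /hdc CodeSeq.codeK. Qed.

Lemma dropc_code i s : dropc i (code s) = code (drop i s).
Proof. by rewrite /dropc CodeSeq.codeK. Qed.

Definition evenb n : nat := ~~ odd n.

Lemma compk_evenb k F : compk k F -> compk k (fun v => evenb (F v)).
Proof.
apply: compk_comp1.
apply: compk_ext (compk_rec (G := fun _ r _ => 1 - r) (compk_proj 1 0)
  (compk_const 1 1) (compkB (compk_const 3 1) (compk_proj 3 1))).
move=> v _ /=; elim: (nth 0 v 0) => [|n /= ->] //.
by rewrite /evenb /=; case: (odd n).
Qed.

Lemma compk_half k F : compk k F -> compk k (fun v => (F v)./2).
Proof.
apply: compk_comp1.
apply: compk_ext (compk_rec (G := fun n r _ => r + (1 - evenb n)) (compk_proj 1 0)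
  (compk_const 1 0) (compkD (compk_proj 3 1)
    (compkB (compk_const 3 1) (compk_evenb (compk_proj 3 0))))).
move=> v _ /=; elim: (nth 0 v 0) => [|n /= ->] //.
by rewrite /evenb; have := odd_double_half n; case: (odd n) => /=; lia.
Qed.

(* [code (n :: s)] is [2 ^ n] times an odd number, so halving as long as the number is
   even recovers both [n] and [s]. *)
Definition halfrec c i := nat_rect (fun=> nat) c
  (fun _ r => if evenb r == 0 then r else r./2) i.

Lemma compk_halfrec k C F : compk k C -> compk k F ->
  compk k (fun v => halfrec (C v) (F v)).
Proof.
apply: compk_comp2.
apply: (compk_rec (G := fun _ r _ => if evenb r == 0 then r else r./2)
  (compk_proj 2 1) (compk_proj 2 0)).
exact: compk_if (compk_evenb (compk_proj 4 1)) (compk_proj 4 1)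
  (compk_half (compk_proj 4 1)).
Qed.

Lemma halfrec_exp n m i : odd m -> halfrec (2 ^ n * m) i = 2 ^ (n - i) * m.
Proof.
move=> om; elim: i => [|i IH] /=; first by rewrite subn0.
rewrite -/(halfrec _ _) IH; case: (leqP n i) => Hi.
  have -> : n - i = 0 by lia.
  have -> : n - i.+1 = 0 by lia.
  by rewrite mul1n /evenb om.
have -> : n - i = (n - i.+1).+1 by lia.
rewrite expnS -mulnA mul2n /evenb odd_double /= half_double.
by [].
Qed.

Lemma code_halfrec n s i : halfrec (code (n :: s)) i = 2 ^ (n - i) * (code s).*2.+1.
Proof. by rewrite code_cons halfrec_exp //= odd_double. Qed.

(** The head of a sequence is smaller than its code, so [c] halvings remove the whole power of 2;
    the remaining odd number is twice the code of the tail plus one. *)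
Definition tlc c := (halfrec c c).-1./2.

Lemma tlc_code s : tlc (code s) = code (behead s).
Proof.
case: s => [|n s]; first by [].
rewrite /tlc code_halfrec.
have -> : n - code (n :: s) = 0.
  have := CodeSeq.ltn_code (n :: s) => /=/andP[]; lia.
by rewrite mul1n /= doubleK.
Qed.

Lemma compk_tlc k F : compk k F -> compk k (fun v => tlc (F v)).
Proof.
move=> HF; apply: compk_half; apply: compk_pred; exact: compk_halfrec.
Qed.

Lemma compk_dropc k I F : compk k I -> compk k F ->
  compk k (fun v => dropc (I v) (F v)).
Proof.
apply: compk_comp2.
apply: compk_ext (compk_rec (G := fun _ r _ => tlc r) (compk_proj 2 0)
  (compk_proj 2 1) (compk_tlc (compk_proj 4 1))).
move=> v _ /=; rewrite -[nth 0 v 1]CodeSeq.decodeK dropc_code.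
elim: (nth 0 v 0) => [|n /= ->]; first by rewrite drop0.
by rewrite tlc_code -drop1 drop_drop add1n.
Qed.

(** The head is the exponent of 2 in the code, found by counting the even values among the
    successive halvings. *)
Lemma compk_hdc k F : compk k F -> compk k (fun v => hdc (F v)).
Proof.
apply: compk_comp1.
apply: compk_ext (compk_rec (G := fun i r v => r + evenb (halfrec (nth 0 v 0) i))
  (compk_proj 1 0) (compk_const 1 0) (compkD (compk_proj 3 1)
    (compk_evenb (compk_halfrec _ (compk_proj 3 0))))).
  move=> v _ /=; rewrite -[nth 0 v 0]CodeSeq.decodeK hdc_code.
  case: (decode _) => [//|n s].
  have E i : nat_rect (fun=> nat) 0
      (fun i r => r + evenb (halfrec (code (n :: s)) i)) i = minn i n.
    elim: i => [|i /= ->]; first by rewrite min0n.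
    rewrite code_halfrec /evenb; case: (leqP n i) => Hi.
      have -> : n - i = 0 by lia.
      rewrite mul1n /= odd_double /=; lia.
    have -> : n - i = (n - i.+1).+1 by lia.
    rewrite expnS -mulnA mul2n odd_double /=; lia.
  rewrite E /=; apply/minn_idPr.
  by have := CodeSeq.ltn_code (n :: s) => /=/andP[]; lia.
by apply: compk_ext (compk_proj 3 2) => v _; rewrite nth_drop.
Qed.

End Codes.

Lemma recursiveI (T : countType) (P : T -> Prop) g :
  compk 1 (fun v => g (nth 0 v 0)) ->
  (forall t, P t -> g (pickle t) = 1) -> (forall t, ~ P t -> g (pickle t) = 0) ->
  recursive P.
Proof.
move=> [p Hp] H1 H0; exists p => t; split=> Ht; have := Hp [:: pickle t] erefl => /=.
  by rewrite H1.
by rewrite H0.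
Qed.

Lemma compk_recursive (T : countType) (P : T -> Prop) k (u : seq nat -> T) :
  recursive P -> compk k (fun v => pickle (u v)) ->
  compk k (fun v => `[< P (u v) >] : nat).
Proof.
move=> [p Hp] [q Hq]; exists (PComp p [:: q]) => v Hv.
apply: (@ev_comp p [:: q] v [:: pickle (u v)]).
  by constructor; [apply: Hq | constructor].
have [H1 H0] := Hp (u v).
by case: asboolP.
Qed.

(** The table is 0 beyond the largest key, which is the form [compk_table] asks for. *)
Lemma finite_table (I : finType) (key val : I -> nat) :
  (forall i j, key i = key j -> val i = val j) ->
  exists t B, (forall i, t (key i) = val i) /\ (forall z, B <= z -> t z = t B).
Proof.
move=> Hinj.
pose t z := if [pick i | key i == z] is Some i then val i else 0.
have Ht z : \max_i (key i).+1 <= z -> t z = 0.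
  move=> Hz; rewrite /t; case: pickP => // i /eqP Hi.
  by have := leq_bigmax (F := fun i => (key i).+1) i; rewrite Hi => /leq_trans/(_ Hz); rewrite ltnn.
exists t, (\max_i (key i).+1); split=> [i|z Hz]; last by rewrite !Ht.
rewrite /t; case: pickP => [j /eqP/Hinj //|/(_ i)]; by rewrite eqxx.
Qed.

(** * Programs that read words letter by letter *)

Section Machines.
Local Notation code := CodeSeq.code.
Local Notation decode := CodeSeq.decode.

Definition nthc c j := nth 0 (decode c) j.

Lemma nthcE c j : nthc c j = hdc (dropc j c).
Proof. by rewrite /hdc /dropc CodeSeq.codeK -nth0 nth_drop addn0. Qed.

Lemma compk_nthc k F G : compk k F -> compk k G -> compk k (fun v => nthc (F v) (G v)).
Proof.
move=> HF HG; apply: compk_ext (compk_hdc (compk_dropc HG HF)) => v _.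
by rewrite nthcE.
Qed.

(** The code of the factor of length [l] starting at position [s] of the word coded by [c]. The map
    [san] can force arbitrary numbers to be codes of letters. *)
Definition ucode (san : nat -> nat) c s l :=
  code (mkseq (fun j => san (nthc c (s + j))) l).

Lemma compk_code2 k F G : compk k F -> compk k G ->
  compk k (fun v => 2 ^ F v * (G v).*2.+1).
Proof.
move=> HF HG; apply: compkM (compk_exp2 HF) _; apply: compkS.
by apply: compk_ext (compkD HG HG) => v _; rewrite addnn.
Qed.

Lemma compk_ucode san k C S L : compk 1 (fun v => san (nth 0 v 0)) ->
  compk k C -> compk k S -> compk k L -> compk k (fun v => ucode san (C v) (S v) (L v)).
Proof.
move=> Hs; apply: compk_comp3.
(* A code grows by consing, so the factor is built from its last letter: round [n] prepends the
   letter at offset [l - n.+1]. *)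
apply: compk_ext (compk_rec (N := fun v => nth 0 v 2) (F := fun=> 0)
  (G := fun n r v => 2 ^ san (nthc (nth 0 v 0) (nth 0 v 1 + (nth 0 v 2 - n.+1))) * r.*2.+1)
  (compk_proj 3 2) (compk0 3) _).
  move=> v _; set c := nth 0 v 0; set s := nth 0 v 1; set l := nth 0 v 2.
  have E n : n <= l -> nat_rect (fun=> nat) 0
     (fun n r => 2 ^ san (nthc c (s + (l - n.+1))) * r.*2.+1) n =
     ucode san c (s + (l - n)) n.
    elim: n => [//|n IH] Hn /=; rewrite IH ?(ltnW Hn) // /ucode.
    rewrite [mkseq _ n.+1]/mkseq /= addn0; congr (_ * _.*2.+1).
    rewrite (iotaDl 1 0) -map_comp; congr code; apply: eq_map => j /=.
    by congr (san (nthc c _)); lia.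
  by rewrite E // subnn addn0.
have E i j : nth 0 (drop 2 i) j = nth 0 i j.+2 by move=> *; rewrite nth_drop.
apply: compk_ext (compk_code2 (k := 5) (compk_comp1 Hs (compk_nthc (compk_proj 5 2)
  (compkD (compk_proj 5 3) (compkB (compk_proj 5 4) (compkS (compk_proj 5 0))))))
  (compk_proj 5 1)).
by move=> v _; rewrite !E.
Qed.

Lemma nthc_pickle (T : countType) (w : seq T) i x0 : i < size w ->
  nthc (pickle w) i = pickle (nth x0 w i).
Proof.
by move=> Hi; rewrite /nthc CodeSeq.codeK (nth_map x0).
Qed.

Lemma pickle_seqE (T : countType) (w : seq T) : pickle w = code [seq pickle x | x <- w].
Proof. by []. Qed.

Lemma dropc_pickle (T : countType) (w : seq T) i :
  (dropc i (pickle w) == 0) = (size w <= i).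
Proof.
rewrite pickle_seqE dropc_code -map_drop; case: leqP => Hi.
  by rewrite drop_oversize.
have := size_le_code [seq pickle j | j <- drop i w].
by rewrite size_map size_drop; case: eqP => // ->; lia.
Qed.

Lemma size_le_pickle (T : countType) (w : seq T) : size w <= pickle w.
Proof. by have := size_le_code [seq pickle j | j <- w]; rewrite size_map. Qed.

(** The transition function is a finite table. The loop runs as many rounds as the code of the word
    and idles once the word is exhausted. *)
Lemma recursive_dfa (L Q : finType) (q0 : Q) (step : Q -> L -> Q) (acc : Q -> bool) :
  recursive (fun w : seq L => acc (foldl step q0 w)).
Proof.
have [|t [B [Ht HB]]] := @finite_table (Q * L)%type
   (fun ql => code [:: pickle ql.1; pickle ql.2]) (fun ql => pickle (step ql.1 ql.2)).
  move=> [q l] [q' l'] /(can_inj CodeSeq.codeK) [].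
  by move=> /(pcan_inj pickleK) -> /(pcan_inj pickleK) ->.
have [|ta [Ba [Hta HBa]]] := @finite_table Q pickle (fun q => acc q : nat).
  by move=> i j /(pcan_inj pickleK) ->.
pose G i r v := if dropc i (nth 0 v 0) == 0 then r else
   t (2 ^ r * (2 ^ nthc (nth 0 v 0) i * (0.*2.+1)).*2.+1).
pose g c := ta (nat_rect (fun=> nat) (pickle q0) (fun i r => G i r [:: c]) c).
have Hg w : g (pickle w) = acc (foldl step q0 w).
  rewrite -Hta /g; congr ta.
  have E i : nat_rect (fun=> nat) (pickle q0) (fun i r => G i r [:: pickle w]) i =
     pickle (foldl step q0 (take i w)).
    elim: i => [|i IH] /=; first by rewrite take0.
    rewrite IH /G dropc_pickle; case: leqP => Hi; first by rewrite !take_oversize // leqW.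
    case: w Hi {IH} => [//|x0 w] Hi.
    rewrite (nthc_pickle x0) // (take_nth x0) // foldl_rcons.
    exact: (Ht (_, _)).
  by rewrite E take_oversize // size_le_pickle.
apply: (recursiveI (g := g)) => [|w Hw|w /negP Hw].
- apply: (compk_table HBa).
  have E v : nat_rect (fun=> nat) (pickle q0) (fun i r => G i r v) (nth 0 v 0) =
     nat_rect (fun=> nat) (pickle q0) (fun i r => G i r [:: nth 0 v 0]) (nth 0 v 0) by [].
  apply: compk_ext (fun v _ => E v) _.
  apply: (compk_rec (compk_proj 1 0) (compk_const 1 (pickle q0))).
  have E2 (v : seq nat) : nth 0 (drop 2 v) 0 = nth 0 v 2 by rewrite nth_drop.
  rewrite /G; apply: (compk_ext (F := fun v => if dropc (nth 0 v 0) (nth 0 v 2) == 0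
    then nth 0 v 1 else t (2 ^ nth 0 v 1 * (2 ^ nthc (nth 0 v 2) (nth 0 v 0) * (0.*2.+1)).*2.+1))).
    by move=> v _; rewrite E2.
  apply: compk_if (compk_dropc (compk_proj 3 0) (compk_proj 3 2)) (compk_proj 3 1) _.
  apply: (compk_table HB); apply: compk_code2 (compk_proj 3 1) _.
  exact: compk_code2 (compk_nthc (compk_proj 3 2) (compk_proj 3 0)) (compk0 3).
- by rewrite Hg Hw.
- by rewrite Hg (negbTE Hw).
Qed.

(* [bits s] is the power of 2 that makes concatenation arithmetic on codes. *)
Definition bits (s : seq nat) := foldr (fun n m => 2 ^ n.+1 * m) 1 s.

Lemma code_cat s t : code (s ++ t) = code s + bits s * code t.
Proof.
elim: s => [|n s IH]; first by rewrite /= mul1n.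
rewrite cat_cons !code_cons IH /= expnS; set a := code s; set b := code t.
by rewrite -!muln2; lia.
Qed.

Lemma bits_cat s t : bits (s ++ t) = bits s * bits t.
Proof. by elim: s => [|n s IH] /=; rewrite ?mul1n // IH mulnA. Qed.

(** * Group words computed by recursion along a word of the subshift *)

Section Growth.
Variables (A L : finType) (m : nat) (E0 B : seq A -> seq L).

(* The commutator of [b] and [e^-1] for elements [b], [e] of order 3. *)
Definition grow_step (e b : seq L) := b ++ e ++ e ++ b ++ b ++ e.

(** After [k] steps the prefix of length [m + k] has been treated; each step looks only at the last
    [m.+1] letters of the prefix, so that [E0] and [B] are needed on finitely many words. *)
Fixpoint grow (w : seq A) k : seq L :=
  if k is k'.+1 then grow_step (grow w k') (B (take m.+1 (drop k' w)))
  else E0 (take m w).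

Local Notation pbits s := (bits [seq pickle x | x <- s]).

Lemma bseq_table d (f : seq A -> nat) : exists t Bd,
  (forall s : seq A, size s <= d -> t (pickle s) = f s) /\
  (forall z, Bd <= z -> t z = t Bd).
Proof.
have [|t [Bd [Ht HB]]] := @finite_table {bseq d of A}
  (fun b => pickle (val b)) (fun b => f (val b)).
  by move=> i j /(pcan_inj pickleK) ->.
by exists t, Bd; split=> // s Hs; have := Ht (Bseq Hs).
Qed.

Definition sizec c := nat_rect (fun=> nat) 0
  (fun i r => if dropc i c == 0 then r else r.+1) c.

Lemma sizec_pickle (T : countType) (w : seq T) : sizec (pickle w) = size w.
Proof.
rewrite /sizec; have E i : nat_rect (fun=> nat) 0
    (fun i r => if dropc i (pickle w) == 0 then r else r.+1) i = minn i (size w).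
  elim: i => [|i /= ->]; first by rewrite min0n.
  rewrite dropc_pickle; case: leqP; lia.
by rewrite E; have := size_le_pickle w; lia.
Qed.

Lemma compk_sizec k F : compk k F -> compk k (fun v => sizec (F v)).
Proof.
apply: compk_comp1; apply: compk_rec (compk_proj 1 0) (compk0 1) _.
apply: (compk_ext (F := fun v => if dropc (nth 0 v 0) (nth 0 v 2) == 0
    then nth 0 v 1 else (nth 0 v 1).+1)); first by move=> v _; rewrite nth_drop.
exact: compk_if (compk_dropc (compk_proj 3 0) (compk_proj 3 2)) (compk_proj 3 1)
   (compkS (compk_proj 3 1)).
Qed.

Lemma ucode_id (w : seq A) s l : s + l <= size w ->
  ucode id (pickle w) s l = pickle (take l (drop s w)).
Proof.
move=> Hs; rewrite /ucode [RHS]pickle_seqE; congr code.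
case: w Hs => [|x0 w] Hs.
  by have -> : l = 0 by move: Hs => /=; lia.
have Sz : size (take l (drop s (x0 :: w))) = l.
  by rewrite size_take size_drop; case: ltnP => //; lia.
apply: (@eq_from_nth _ 0); first by rewrite size_mkseq size_map Sz.
move=> i; rewrite size_mkseq => Hi.
rewrite nth_mkseq // (nth_map x0) ?Sz // nth_take // nth_drop.
by apply: (nthc_pickle x0); apply: leq_trans Hs; rewrite ltn_add2l.
Qed.

(** By [code_cat] and [bits_cat], the pair formed by the code and the [bits] of the grown word
    satisfies a primitive recursion with finite tables as input; the result is then handed to the
    program for [WP]. *)
Lemma recursive_growth (WP : seq L -> Prop) : recursive WP ->
  recursive (fun w => ~ WP (grow w (size w - m))).
Proof.
move=> HWP.
have [t0 [b0 [Ht0 Hb0]]] := bseq_table m (fun s => pickle (E0 s)).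
have [p0 [c0 [Hp0 Hc0]]] := bseq_table m (fun s => pbits (E0 s)).
have [t1 [b1 [Ht1 Hb1]]] := bseq_table m.+1 (fun s => pickle (B s)).
have [p1 [c1 [Hp1 Hc1]]] := bseq_table m.+1 (fun s => pbits (B s)).
(* [P] follows the [bits] and [E] the code of the grown word; their bodies are [grow_step] expanded
   factor by factor. *)
pose P k c := nat_rect (fun=> nat) (p0 (ucode id c 0 (minn m (sizec c))))
  (fun i r => let b := p1 (ucode id c i m.+1) in b * (r * (r * (b * (b * r))))) k.
pose E k c := nat_rect (fun=> nat) (t0 (ucode id c 0 (minn m (sizec c))))
  (fun i r => let b := p1 (ucode id c i m.+1) in let d := t1 (ucode id c i m.+1) in
     let p := P i c in d + b * (r + p * (r + p * (d + b * (d + b * r))))) k.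
have H0 (w : seq A) : ucode id (pickle w) 0 (minn m (sizec (pickle w))) = pickle (take m w).
  rewrite sizec_pickle ucode_id ?add0n ?geq_minr // drop0; congr pickle.
  case: (leqP (size w) m) => H; first by rewrite !take_oversize.
  by [].
have PS k c (b := p1 (ucode id c k m.+1)) :
  P k.+1 c = b * (P k c * (P k c * (b * (b * P k c)))) by [].
have ES k c (b := p1 (ucode id c k m.+1)) (d := t1 (ucode id c k m.+1)) (p := P k c) :
  E k.+1 c = d + b * (E k c + p * (E k c + p * (d + b * (d + b * E k c)))) by [].
have HP (w : seq A) k : k <= size w - m -> P k (pickle w) = pbits (grow w k).
  elim: k => [_|k IH Hk].
    by rewrite /= H0 Hp0 // size_take; case: ltnP; lia.
  rewrite PS IH ?(ltnW Hk) // ucode_id; last lia.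
  rewrite Hp1; last by rewrite size_take size_drop; case: ltnP; lia.
  by rewrite /grow_step !map_cat !bits_cat.
have HE (w : seq A) k : k <= size w - m -> E k (pickle w) = pickle (grow w k).
  elim: k => [_|k IH Hk].
    by rewrite /= H0 Ht0 // size_take; case: ltnP; lia.
  rewrite ES IH ?(ltnW Hk) // HP ?(ltnW Hk) // ucode_id; last lia.
  have Hs : size (take m.+1 (drop k w)) <= m.+1.
    by rewrite size_take size_drop; case: ltnP; lia.
  by rewrite Hp1 // Ht1 // /grow_step !pickle_seqE !map_cat !code_cat.
have cU S k : compk k.+1 S ->
  compk k.+1 (fun v => ucode id (nth 0 v k) (S v) m.+1).
  move=> HS; exact: (compk_ucode (san := id) (compk_proj 1 0) (compk_proj k.+1 k) HS
    (compk_const k.+1 m.+1)).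
have c0' k : compk k.+1 (fun v => ucode id (nth 0 v k) 0 (minn m (sizec (nth 0 v k)))).
  apply: (compk_ucode (san := id) (compk_proj 1 0) (compk_proj k.+1 k) (compk0 k.+1)).
  apply: compk_ext (compkB (compk_const k.+1 m)
    (compkB (compk_const k.+1 m) (compk_sizec (compk_proj k.+1 k)))).
  by move=> v _; lia.
have cP k : compk k.+1 (fun v => P (nth 0 v 0) (nth 0 v k)).
  apply: (compk_rec (k := k.+1) (G := fun i r v => let b := p1 (ucode id (nth 0 v k) i m.+1) in
     b * (r * (r * (b * (b * r))))) (compk_proj _ 0) (compk_table Hc0 (c0' k))) => /=.
  have cb : compk k.+3 (fun v => p1 (ucode id (nth 0 (drop 2 v) k) (nth 0 v 0) m.+1)).
    apply: compk_ext (compk_table Hc1 (cU (fun v => nth 0 v 0) k.+2 (compk_proj _ 0))).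
    by move=> v _; rewrite nth_drop.
  have cr := compk_proj k.+3 1.
  exact: compkM cb (compkM cr (compkM cr (compkM cb (compkM cb cr)))).
have cE : compk 2 (fun v => E (nth 0 v 0) (nth 0 v 1)).
  apply: (compk_rec (k := 2) (G := fun i r v => let b := p1 (ucode id (nth 0 v 1) i m.+1) in
     let d := t1 (ucode id (nth 0 v 1) i m.+1) in
     let p := P i (nth 0 v 1) in d + b * (r + p * (r + p * (d + b * (d + b * r)))))
     (compk_proj _ 0) (compk_table Hb0 (c0' 1))) => /=.
  have cb : compk 4 (fun v => p1 (ucode id (nth 0 (drop 2 v) 1) (nth 0 v 0) m.+1)).
    apply: compk_ext (compk_table Hc1 (cU (fun v => nth 0 v 0) 3 (compk_proj _ 0))).
    by move=> v _; rewrite nth_drop.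
  have cd : compk 4 (fun v => t1 (ucode id (nth 0 (drop 2 v) 1) (nth 0 v 0) m.+1)).
    apply: compk_ext (compk_table Hb1 (cU (fun v => nth 0 v 0) 3 (compk_proj _ 0))).
    by move=> v _; rewrite nth_drop.
  have cp : compk 4 (fun v => P (nth 0 v 0) (nth 0 (drop 2 v) 1)).
    by apply: compk_ext (cP 3) => v _; rewrite nth_drop.
  have cr := compk_proj 4 1.
  exact: compkD cd (compkM cb (compkD cr (compkM cp (compkD cr (compkM cp
    (compkD cd (compkM cb (compkD cd (compkM cb cr))))))))).
have [pW HpW] := HWP.
have [pE HpE] : compk 1 (fun v => E (sizec (nth 0 v 0) - m) (nth 0 v 0)).
  apply: (compk_comp2 (f := fun k c => E k c) cE _ (compk_proj 1 0)).
  exact: compkB (compk_sizec (compk_proj 1 0)) (compk_const 1 m).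
have [pN HpN] : compk 1 (fun v => 1 - nth 0 v 0).
  exact: compkB (compk_const 1 1) (compk_proj 1 0).
exists (PComp pN [:: PComp pW [:: pE]]) => w.
have Hw : pevals [:: pE] [:: pickle w] [:: pickle (grow w (size w - m))].
  constructor; last by constructor.
  by have := HpE [:: pickle w] erefl; rewrite /= sizec_pickle HE.
have [HW1 HW0] := HpW (grow w (size w - m)).
split=> [/HW0 H|/contrapT/HW1 H].
- apply: (@ev_comp _ _ _ [:: 0]); last exact: (HpN [:: 0]).
  by constructor; [apply: ev_comp Hw H | constructor].
- apply: (@ev_comp _ _ _ [:: 1]); last exact: (HpN [:: 1]).
  by constructor; [apply: ev_comp Hw H | constructor].
Qed.
End Growth.
End Machines.

(** * Simulation of a group word on a finite word *)

Section Simulation.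
Local Notation code := CodeSeq.code.
Local Notation decode := CodeSeq.decode.
Variables (A L : finType) (W M : nat) (mv : L -> seq A -> nat).

Definition window (a : A) u pos := mkseq (fun i => nth a u (pos + i)) W.

(* [mv] is offset by [M] so that the positions stay natural numbers. *)
Definition walk (a : A) (u : seq A) (pos : nat) (w : seq L) :=
  foldl (fun pos l => pos + mv l (window a u pos) - M) pos w.

(** The words [u] have a fixed length and a finite alphabet, so their codes are bounded and all of
    them can be tested. The margin [M * pickle w] on both sides leaves room for one move of length
    [M] per letter of [w]. *)
Lemma recursive_walk (a0 : A) (lang : seq A -> Prop) : recursive lang ->
  exists a, recursive (fun w : seq L => forall u, size u = W + 2 * (M * pickle w) ->
    lang u -> walk a u (M * pickle w) w = M * pickle w).
Proof.
move=> Hlang.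
pose sa z := if [pick a : A | pickle a == z] is Some a then a else a0.
have saK a : sa (pickle a) = a.
  by rewrite /sa; case: pickP => [b /eqP/(pcan_inj pickleK) // | /(_ a)]; rewrite eqxx.
pose B := \max_(a : A) (pickle a).+1.
have ltB (a : A) : pickle a < B by rewrite /B (bigD1 a) //= leq_maxl.
pose san z := pickle (sa z).
have Hsan z : B <= z -> san z = san B.
  have sa_out y : B <= y -> sa y = a0.
    by rewrite /sa; case: pickP => // a /eqP <-; have := ltB a; lia.
  by move=> Hz; rewrite /san !sa_out.
have cs : compk 1 (fun v => san (nth 0 v 0)) := compk_table Hsan (compk_proj 1 0).
pose lw c l := mkseq (fun j => sa (nthc c j)) l.
have lwE c l : ucode san c 0 l = pickle (lw c l).
  by rewrite pickle_seqE /lw /mkseq -map_comp.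
have lwK (u : seq A) : lw (pickle u) (size u) = u.
  apply: (@eq_from_nth _ a0); rewrite size_mkseq // => i Hi.
  by rewrite nth_mkseq // (nthc_pickle a0).
have winE (u : seq A) pos : ucode san (pickle u) pos W = pickle (window (sa 0) u pos).
  rewrite [RHS]pickle_seqE /ucode /window /mkseq -[in RHS]map_comp.
  congr code; apply: eq_map => j /=.
  rewrite /san; congr pickle.
  case: (ltnP (pos + j) (size u)) => H; first by rewrite (nthc_pickle (sa 0)).
  by rewrite [RHS]nth_default // /nthc nth_default // CodeSeq.codeK size_map.
have [|t [Bt [Ht HBt]]] := @finite_table (L * {bseq W of A})%type
   (fun ls => 2 ^ pickle ls.1 * (pickle (val ls.2)).*2.+1) (fun ls => mv ls.1 (val ls.2)).
  move=> [l s] [l' s']; rewrite [_.1]/= [_.2]/= [pickle (val s)]pickle_seqE.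
  rewrite [_.1]/= [_.2]/= [pickle (val s')]pickle_seqE -!code_cons.
  move/(can_inj CodeSeq.codeK) => [] /(pcan_inj pickleK) ->.
  by move/(inj_map (pcan_inj pickleK)) => /= ->.
(* Reading beyond the end of a word yields the number 0, so the default letter has to be the one
   that [sa] assigns to 0. *)
exists (sa 0).
pose ln cw := W + 2 * (M * cw).
pose pos i c cw := nat_rect (fun=> nat) (M * cw)
  (fun i r => if dropc i cw == 0 then r else
     r + t (2 ^ nthc cw i * (ucode san c r W).*2.+1) - M) i.
have posS i c cw : pos i.+1 c cw = if dropc i cw == 0 then pos i c cw else
     pos i c cw + t (2 ^ nthc cw i * (ucode san c (pos i c cw) W).*2.+1) - M by [].
have posE (u : seq A) (w : seq L) :
    pos (pickle w) (pickle u) (pickle w) = walk (sa 0) u (M * pickle w) w.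
  have E i : pos i (pickle u) (pickle w) = walk (sa 0) u (M * pickle w) (take i w).
    elim: i => [|i IH]; first by rewrite take0.
    rewrite posS IH dropc_pickle; case: leqP => Hi; first by rewrite !take_oversize // leqW.
    have l0 : L by case: (w) Hi.
    rewrite (take_nth l0) // /walk foldl_rcons -/(walk _ _ _ _) winE (nthc_pickle l0) //.
    have Hs : size (window (sa 0) u (walk (sa 0) u (M * pickle w) (take i w))) <= W.
      by rewrite size_mkseq.
    by rewrite (Ht (_, Bseq Hs)).
  by rewrite E take_oversize // size_le_pickle.
(* Every number [c] is read as some word of the right length. Numbers that are not codes of such
   words merely repeat a test on another word. *)
pose ok c cw := if (`[< lang (lw c (ln cw)) >] : nat) == 0 then 1 else
   (pos cw (ucode san c 0 (ln cw)) cw == M * cw : nat).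
pose bd cw := 2 ^ (B.+1 * ln cw).
pose g cw := nat_rect (fun=> nat) 1 (fun c r => r * ok c cw) (bd cw).
have cln k F : compk k F -> compk k (fun v => ln (F v)).
  move=> HF; apply: compkD (compk_const _ _) (compkM (compk_const _ _) _).
  exact: compkM (compk_const _ _) HF.
have cpos : compk 3 (fun v => pos (nth 0 v 0) (nth 0 v 1) (nth 0 v 2)).
  apply: (compk_rec (k := 3) (G := fun i r v => if dropc i (nth 0 v 2) == 0 then r else
     r + t (2 ^ nthc (nth 0 v 2) i * (ucode san (nth 0 v 1) r W).*2.+1) - M)
     (compk_proj _ 0) (compkM (compk_const _ _) (compk_proj _ 2))).
  have E (v : seq nat) i : nth 0 (drop 2 v) i = nth 0 v i.+2 by rewrite nth_drop.
  apply: (compk_ext (F := fun v => if dropc (nth 0 v 0) (nth 0 v 4) == 0 then nth 0 v 1 else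
     nth 0 v 1 + t (2 ^ nthc (nth 0 v 4) (nth 0 v 0) *
       (ucode san (nth 0 v 3) (nth 0 v 1) W).*2.+1) - M)); first by move=> v _; rewrite !E.
  apply: (compk_if (k := 5) (compk_dropc (compk_proj _ 0) (compk_proj _ 4)) (compk_proj _ 1)).
  apply: compkB (compkD (compk_proj _ 1) (compk_table HBt _)) (compk_const _ _).
  apply: compk_code2 (compk_nthc (compk_proj _ 4) (compk_proj _ 0)) _.
  exact: compk_ucode cs (compk_proj _ 3) (compk_proj _ 1) (compk_const _ _).
have cok : compk 2 (fun v => ok (nth 0 v 0) (nth 0 v 1)).
  have cu : compk 2 (fun v => ucode san (nth 0 v 0) 0 (ln (nth 0 v 1))).
    exact: compk_ucode cs (compk_proj _ 0) (compk0 _) (cln _ _ (compk_proj _ 1)).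
  apply: compk_if (compk_const _ 1) _.
    apply: (compk_recursive (u := fun v => lw (nth 0 v 0) (ln (nth 0 v 1))) Hlang).
    by apply: compk_ext cu => v _; rewrite lwE.
  apply: compk_eq (compkM (compk_const _ _) (compk_proj _ 1)).
  exact: (compk_comp3 (f := pos) cpos (compk_proj _ 1) cu (compk_proj _ 1)).
have ok01 c cw : ok c cw <= 1 by rewrite /ok; case: ifP => // _; case: eqP.
have okP (u : seq A) (w : seq L) : size u = ln (pickle w) -> ok (pickle u) (pickle w) = 1 ->
    lang u -> walk (sa 0) u (M * pickle w) w = M * pickle w.
  move=> su; rewrite /ok lwE -su lwK posE.
  by case: asboolP => // _ /=; case: eqP.
have pE (Q : nat -> nat) b : (forall c, Q c <= 1) ->
    nat_rect (fun=> nat) 1 (fun c r => r * Q c) b = (all (fun c => Q c == 1) (iota 0 b)).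
  move=> HQ; elim: b => [//|b]; have -> : iota 0 b.+1 = iota 0 b ++ [:: b] by rewrite -addn1 iotaD.
  rewrite all_cat [nat_rect _ _ _ _.+1]/= => ->.
  by rewrite /= andbT; have := HQ b; case: (Q b) => [|[]] //; case: all.
apply: (recursiveI (g := g)) => [|w Hw|w Hw]; rewrite /g.
- apply: (compk_rec (k := 1) (N := fun v => bd (nth 0 v 0)) (F := fun=> 1)
    (G := fun c r v => r * ok c (nth 0 v 0))).
  + exact: compk_exp2 (compkM (compk_const _ _) (cln _ _ (compk_proj _ 0))).
  + exact: compk_const.
  apply: compkM (compk_proj _ 1) _.
  apply: (compk_ext (F := fun v => ok (nth 0 v 0) (nth 0 v 2))).
    by move=> v _; rewrite nth_drop.
  exact: (compk_comp2 (f := ok) cok (compk_proj _ 0) (compk_proj _ 2)).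
- rewrite pE //; suff -> : all (fun c => ok c (pickle w) == 1) (iota 0 (bd (pickle w))) by [].
  apply/allP => c _; rewrite /ok; case: asboolP => //= Hl.
  rewrite lwE posE Hw ?eqxx // /lw size_mkseq //.
- rewrite pE //; case E: all => //; case: Hw => u su Hl.
  apply: okP => //; apply/eqP; move/allP: E; apply.
  have su' : ln (pickle w) = size u by rewrite su.
  rewrite mem_iota /= add0n /bd su' pickle_seqE.
  have := @code_lt B [seq pickle a | a <- u]; rewrite size_map; apply.
  by apply/allP => _ /mapP [a _ ->]; apply: ltnW.
Qed.
End Simulation.

(** * Locally constant functions and compactness *)

Import Order.TTheory GRing.Theory Num.Theory.
Local Open Scope ring_scope.

Lemma fin_bound (I : finType) (P : I -> nat -> Prop) :
  (forall i m n, (m <= n)%N -> P i m -> P i n) -> (forall i, exists n, P i n) ->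
  exists n, forall i, P i n.
Proof.
move=> mono /choice [f Hf]; exists (\max_i f i)%N => i.
exact: mono (leq_bigmax _) (Hf i).
Qed.

Notation sh := shiftn.

Section Windows.
Variable A : finType.
Notation X := (int -> A).
Implicit Types (x y z : X).

Lemma sh0 x : sh 0 x = x.
Proof. by apply: funext => m; rewrite /sh addr0. Qed.

Lemma shD a b x : sh a (sh b x) = sh (a + b) x.
Proof. by apply: funext => m; rewrite /sh addrA. Qed.

Lemma shK a x : sh (- a) (sh a x) = x.
Proof. by rewrite shD addNr sh0. Qed.

Lemma shKV a x : sh a (sh (- a) x) = x.
Proof. by rewrite shD addrN sh0. Qed.

Lemma agreeC n x y : agree n x y -> agree n y x.
Proof. by move=> H m Hm; rewrite H. Qed.

Lemma agreeT n x y z : agree n x y -> agree n y z -> agree n x z.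
Proof. by move=> H H' m Hm; rewrite H // H'. Qed.

Lemma agreeW m n x y : (n <= m)%N -> agree m x y -> agree n x y.
Proof. by move=> Hmn H i Hi; apply: H; apply: leq_trans Hmn. Qed.

Lemma agree_sh n k x y : agree (n + `|k|) x y -> agree n (sh k x) (sh k y).
Proof. move=> H m Hm; apply: H; lia. Qed.

Definition win n x : {ffun 'I_(2 * n).+1 -> A} := [ffun i : 'I_(2 * n).+1 => x (i%:Z - n%:Z)].

Lemma winP n x y : win n x = win n y <-> agree n x y.
Proof.
split=> [E m Hm | E].
  have Hi : (absz (m + n%:Z)%R < (2 * n).+1)%N by lia.
  move/ffunP/(_ (Ordinal Hi)): E; rewrite !ffunE /=.
  by have -> : (absz (m + n%:Z)%R)%:Z - n%:Z = m by lia.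
apply/ffunP => i; rewrite !ffunE; apply: E; have := ltn_ord i; lia.
Qed.

Variable Om : X -> Prop.

(** The radius is the same for all points. For integer-valued functions on a closed shift-invariant
    set this is continuity, see [cont_lc]; the uniform form is what closure under the operations
    below and finite tables require. *)
Definition lc (B : Type) (f : X -> B) : Prop :=
  exists n, forall x y, Om x -> Om y -> agree n x y -> f x = f y.

Lemma lc_win n : lc (win n).
Proof. by exists n => x y _ _ /winP. Qed.

Lemma lc_const B (b : B) : lc (fun=> b).
Proof. by exists 0%N. Qed.

Lemma lc_eq B (f g : X -> B) : (forall x, Om x -> f x = g x) -> lc f -> lc g.
Proof.
by move=> E [n H]; exists n => x y Hx Hy /H; rewrite !E //; apply.
Qed.

Lemma lc_map B C (g : B -> C) (f : X -> B) : lc f -> lc (fun x => g (f x)).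
Proof. by move=> [n H]; exists n => x y Hx Hy Hxy; rewrite (H x y). Qed.

Lemma lc_map2 B C D (h : B -> C -> D) (f : X -> B) (g : X -> C) :
  lc f -> lc g -> lc (fun x => h (f x) (g x)).
Proof.
move=> [n H] [m H']; exists (maxn n m) => x y Hx Hy Hxy.
rewrite (H x y) ?(H' x y) //; apply: agreeW Hxy; lia.
Qed.

Lemma lc_ffun (I : finType) B (F : I -> X -> B) :
  (forall i, lc (F i)) -> lc (fun x => [ffun i => F i x]).
Proof.
move=> H; have [|n Hn] := fin_bound _ H.
  by move=> i m n Hmn Hm x y Hx Hy Hxy; apply: Hm => //; apply: agreeW Hxy.
by exists n => x y Hx Hy Hxy; apply/ffunP => i; rewrite !ffunE; apply: Hn.
Qed.

Hypothesis OmS : shift_invariant Om.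

Lemma Om_sh k x : Om (sh k x) <-> Om x.
Proof.
have Hn (n : nat) y : Om (sh n%:Z y) <-> Om y.
  elim: n => [|n IH]; first by rewrite sh0.
  by rewrite -IH (OmS (sh n%:Z y)) /shiftT shD intS.
case: (lerP 0 k) => Hk.
  by have E : k = (absz k)%:Z by [lia]; rewrite E; apply: Hn.
have := Hn (absz k) (sh k x); rewrite shD.
have -> : (absz k)%:Z + k = 0 by lia.
by rewrite sh0 => -[H1 H2]; split.
Qed.

Lemma lc_sh B (f : X -> B) k : lc f -> lc (fun x => f (sh k x)).
Proof.
move=> [n H]; exists (n + `|k|)%N => x y Hx Hy Hxy.
by apply: H; rewrite ?Om_sh //; apply: agree_sh.
Qed.

Lemma lc_bounded (f : X -> int) : lc f ->
  exists M : nat, forall x, Om x -> (absz (f x) <= M)%N.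
Proof.
move=> [n H].
have [|w|M HM] := @fin_bound {ffun 'I_(2 * n).+1 -> A}
    (fun w M => forall x, Om x -> win n x = w -> (absz (f x) <= M)%N).
- by move=> w m m' Hm Hw x Hx /(Hw _ Hx) /leq_trans; apply.
- case: (pselect (exists x, Om x /\ win n x = w)) => [[x [Hx Hw]]|Hn].
    exists (absz (f x)) => y Hy; rewrite -Hw => /winP Hyx.
    by rewrite (H y x).
  by exists 0%N => x Hx Hw; case: Hn; exists x.
by exists M => x Hx; apply: HM.
Qed.

Lemma lc_shv B (f : X -> B) (k : X -> int) : lc f -> lc k ->
  lc (fun x => f (sh (k x) x)).
Proof.
move=> [n H] lck; have [M HM] := lc_bounded lck; have [m Hm] := lck.
exists (n + M + m)%N => x y Hx Hy Hxy; rewrite (Hm x y) //; last first.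
  by apply: agreeW Hxy; lia.
apply: H; rewrite ?Om_sh //; apply: agree_sh; apply: agreeW Hxy.
by have := HM y Hy; lia.
Qed.

Lemma lc_ex N (P : 'I_N -> X -> bool) : (forall i, lc (P i)) ->
  lc (fun x => [exists i, P i x]).
Proof.
move=> H.
apply: lc_eq (lc_map (fun f : {ffun 'I_N -> bool} => [exists i, f i]) (lc_ffun H)) => x _.
by apply: eq_existsb => i; rewrite ffunE.
Qed.

Hypothesis OmC : closed_set Om.

(** A failure everywhere would persist, as there are finitely many windows, in some extension of
    every bad window. This yields a sequence of points agreeing on growing windows; its limit lies
    in [Om] and contradicts the local bound. *)
Lemma compactness (P : nat -> X -> Prop) :
  (forall m n x, (m <= n)%N -> P m x -> P n x) ->
  (forall x, Om x -> exists n m, forall y, Om y -> agree m x y -> P n y) ->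
  exists n, forall x, Om x -> P n x.
Proof.
move=> mono loc; apply: contrapT => Hbad.
pose bad k y := ~ exists n, forall z, Om z -> agree k y z -> P n z.
have bad0 : exists y, Om y /\ bad 0%N y.
  apply: contrapT => H; apply: Hbad.
  have [|w|n Hn] := @fin_bound {ffun 'I_(2 * 0).+1 -> A}
     (fun w n => forall z, Om z -> win 0 z = w -> P n z).
  - by move=> w m n Hmn Hm z Hz /(Hm _ Hz); apply: mono.
  - case: (pselect (exists x, Om x /\ win 0 x = w)) => [[x [Hx Hw]]|Hw].
      have [n Hn] : exists n, forall z, Om z -> agree 0 x z -> P n z.
        by apply: contrapT => Hb; apply: H; exists x.
      by exists n => z Hz Hzw; apply: Hn => //; apply/winP; rewrite Hw.
    by exists 0%N => z Hz Hzw; case: Hw; exists z.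
  by exists n => x Hx; apply: Hn.
have badS k y : Om y -> bad k y -> exists z, [/\ Om z, agree k y z & bad k.+1 z].
  move=> Hy Hb; apply: contrapT => H; apply: Hb.
  have [|w|n Hn] := @fin_bound {ffun 'I_(2 * k.+1).+1 -> A}
     (fun w n => forall z, Om z -> agree k y z -> win k.+1 z = w -> P n z).
  - by move=> w m n Hmn Hm z Hz Hyz /(Hm _ Hz Hyz); apply: mono.
  - case: (pselect (exists x, [/\ Om x, agree k y x & win k.+1 x = w])).
      move=> [x [Hx Hyx Hw]].
      have [n Hn] : exists n, forall z, Om z -> agree k.+1 x z -> P n z.
        by apply: contrapT => Hb; apply: H; exists x.
      by exists n => z Hz _ Hzw; apply: Hn => //; apply/winP; rewrite Hw.
    by move=> Hw; exists 0%N => z Hz Hyz Hzw; case: Hw; exists z.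
  by exists n => x Hx Hyx; apply: (Hn (win k.+1 x)).
have /choice[f Hf] : forall ky : nat * X, exists z, Om ky.2 -> bad ky.1 ky.2 ->
    [/\ Om z, agree ky.1 ky.2 z & bad ky.1.+1 z].
  move=> [k y]; case: (pselect (Om y /\ bad k y)) => [[Hy Hb]|H].
    by have [z Hz] := badS k y Hy Hb; exists z.
  by exists y => Hy Hb; case: H.
have [y0 [Hy0 Hb0]] := bad0.
pose y := nat_rect (fun=> X) y0 (fun k y => f (k, y)).
have Hy k : Om (y k) /\ bad k (y k).
  elim: k => [//|k [IH1 IH2]]; by have [] := Hf (k, y k) IH1 IH2.
have Hyy k l : (k <= l)%N -> agree k (y k) (y l).
  move=> /subnK <-; elim: (l - k)%N => [//|d IH].
  rewrite addSn; apply: agreeT IH _.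
  have [H1 H2] := Hy (d + k)%N.
  have [_ H _] := Hf (_, _) H1 H2; apply: agreeW H => /=; lia.
pose x : X := fun m => y (absz m) m.
have Hx k : agree k x (y k).
  by move=> m Hm; rewrite /x; apply: (Hyy _ _ Hm).
have Ox : Om x by apply: OmC => n; exists (y n) => //; case: (Hy n).
have [n [m Hm]] := loc x Ox.
have [_ []] := Hy m; exists n => z Hz Hyz; apply: Hm => //.
exact: agreeT Hyz.
Qed.

Lemma cont_lc (f : X -> int) : cont_int_on Om f -> lc f.
Proof.
move=> H; have [||n Hn] := @compactness (fun n x => forall y, Om y -> agree n x y -> f y = f x).
- by move=> m n x Hmn Hm y Hy Hxy; apply: Hm => //; apply: agreeW Hxy.
- move=> x Hx; have [m Hm] := H x Hx; exists m, m => y Hy Hxy z Hz Hyz.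
  by rewrite !Hm //; apply: agreeT Hyz.
by exists n => x y Hx Hy Hxy; rewrite (Hn y Hy x) //; apply: agreeC.
Qed.

Hypothesis aper : forall x k, Om x -> sh k x = x -> k = 0.

Lemma sh_inj x a b : Om x -> sh a x = sh b x -> a = b.
Proof.
move=> Hx E; suff : b - a = 0 by lia.
apply: (@aper (sh a x)); first by rewrite Om_sh.
by rewrite shD subrK.
Qed.

(** Equivalently the shifts of [P] by [0, ..., N - 1] are pairwise disjoint on [Om]: [P] is the base
    of a tower with [N] levels. *)
Definition sep N (P : X -> bool) := forall x, Om x -> P x ->
  forall k : int, 0 < k < N%:Z -> ~~ P (sh k x).

Lemma uniform_aperiodicity N : exists n, forall x, Om x ->
  forall k : int, 0 < k < N%:Z -> ~ agree n x (sh k x).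
Proof.
apply: (compactness (P := fun n x => forall k : int, 0 < k < N%:Z -> ~ agree n x (sh k x))).
  by move=> m n x Hmn Hm k Hk Hn; apply: (Hm k Hk); apply: agreeW Hn.
move=> x Hx.
have [n Hn] : exists n, forall i : 'I_N, 0 < i%:Z -> ~ agree n x (sh i%:Z x).
  apply: fin_bound => [i m n Hmn Hm Hi Hn|i].
    by apply: (Hm Hi); apply: agreeW Hn.
  apply: contrapT => H; case: (posnP i) => Hi; first by apply: H; exists 0%N; rewrite Hi.
  suff : i%:Z = 0 by lia.
  apply: (aper Hx); apply: funext => m; apply: contrapT => Hm; apply: H.
  by exists (absz m) => _ Ha; apply: Hm; rewrite -Ha.
exists n, (n + N)%N => y Hy Hxy k Hk Hk'.
have Hi : (absz k < N)%N by lia.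
apply: (Hn (Ordinal Hi)) => /=; first by lia.
have -> : (absz k)%:Z = k by lia.
apply: agreeT (agreeT _ Hk') (agreeC _); first by apply: agreeW Hxy; lia.
apply: agree_sh; apply: agreeW Hxy; lia.
Qed.

Lemma sep_win N : exists n, forall w, sep N (fun x => win n x == w).
Proof.
have [n Hn] := uniform_aperiodicity N; exists n => w x Hx /eqP Hw k Hk.
apply/eqP; rewrite -Hw => /winP /agreeC; exact: Hn.
Qed.

(** A greedy choice: the finitely many windows are treated in turn, and the points showing the
    current window become markers unless a marker is already within distance [N]. Points showing the
    same window are separated by [sep_win]. *)
Lemma marker N : exists U : X -> bool, [/\ lc U, sep N.+1 U &
  forall x, Om x -> exists2 k : int, - N%:Z <= k <= N%:Z & U (sh k x)].
Proof.
have [n Hn] := sep_win N.+1.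
pose near (U : X -> bool) x := [exists i : 'I_(2 * N).+1, U (sh (i%:Z - N%:Z) x)].
have nearI (U : X -> bool) x (k : int) : - N%:Z <= k <= N%:Z -> U (sh k x) -> near U x.
  move=> Hk HU; apply/existsP; have Hi : (absz (k + N%:Z)%R < (2 * N).+1)%N by lia.
  by exists (Ordinal Hi) => /=; have -> : (absz (k + N%:Z)%R)%:Z - N%:Z = k by lia.
suff H (l : seq {ffun 'I_(2 * n).+1 -> A}) : exists U : X -> bool, [/\ lc U, sep N.+1 U &
    forall x, Om x -> win n x \in l -> near U x].
  have [U [H1 H2 H3]] := H (enum {ffun 'I_(2 * n).+1 -> A}).
  exists U; split=> // x Hx; have := H3 x Hx; rewrite mem_enum => /(_ erefl)/existsP[i Hi].
  by exists (i%:Z - N%:Z) => //; have := ltn_ord i; lia.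
elim: l => [|w l [U [lU sU HU]]]; first by exists (fun=> false); split=> //; apply: lc_const.
exists (fun x => U x || (win n x == w) && ~~ near U x); split.
- apply: lc_map2 => //; apply: lc_map2 (lc_map (fun b => b == w) (lc_win n)) _.
  by apply: lc_map; apply: lc_ex => i; apply: lc_sh.
- move=> x Hx /orP[HUx|/andP[Hw Hnx]] k Hk; apply/negP => /orP[HUk|/andP[Hwk Hnk]].
  + by have := sU x Hx HUx k Hk; rewrite HUk.
  + move/negP: Hnk; apply; apply: (nearI _ _ (- k)); first by lia.
    by rewrite shK.
  + move/negP: Hnx; apply; apply: (nearI _ _ k) => //; lia.
  + by have := Hn w x Hx Hw k Hk; rewrite Hwk.
- move=> x Hx; rewrite inE => /orP[Hw|Hl].
    case Hnx: (near U x).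
      case/existsP: Hnx => i Hi; apply/existsP; exists i; by rewrite Hi.
    apply: (nearI _ _ 0); first by lia.
    by rewrite sh0 Hw Hnx orbT.
  case/existsP: (HU x Hx Hl) => i Hi; apply/existsP; exists i; by rewrite Hi.
Qed.
End Windows.

(** * Permutations of the levels of a tower *)

Definition adj n k : 'S_n.+1 := tperm (inord k) (inord k.+1).
(* The cycle k -> k+1 -> k+2 -> k; permutations compose from left to right. *)
Definition cyc3 n k : 'S_n.+1 := (adj n k.+1 * adj n k)%g.

Lemma adjE n k (i : 'I_n.+1) : (k < n)%N ->
  adj n k i = (if i == k :> nat then k.+1 else if i == k.+1 :> nat then k else i) :> nat.
Proof.
move=> Hk; rewrite /adj permE /= -!val_eqE /= !inordK; try lia.
by case: eqP => _; [rewrite inordK | case: eqP => _ //; rewrite inordK]; lia.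
Qed.

Lemma cyc3E n k (i : 'I_n.+1) : (k.+1 < n)%N ->
  cyc3 n k i = (if i == k :> nat then k.+1 else if i == k.+1 :> nat then k.+2
     else if i == k.+2 :> nat then k else i) :> nat.
Proof.
move=> Hk; have Hk' := ltnW Hk; rewrite /cyc3 permM !adjE //.
case: (@eqP _ (i : nat) k.+1) => H1; case: (@eqP _ (i : nat) k.+2) => H2;
  case: (@eqP _ (i : nat) k) => H3; do ?(case: eqP => ?); lia.
Qed.

Lemma cyc3_cube n k : (k.+1 < n)%N -> (cyc3 n k * (cyc3 n k * cyc3 n k) = 1)%g.
Proof.
move=> Hk; apply/permP => i; apply: val_inj.
have E j := cyc3E j Hk; move: (cyc3 n k) E => u E; rewrite !permM perm1 /=.
have F : ((k.+1 == k) = false) * ((k.+2 == k) = false) * ((k.+2 == k.+1) = false).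
  by do !split; lia.
case: (eqVneq (i : nat) k) => H1; first by rewrite !(E, H1, eqxx, F).
case: (eqVneq (i : nat) k.+1) => H2; first by rewrite !(E, H2, eqxx, F).
case: (eqVneq (i : nat) k.+2) => H3; first by rewrite !(E, H3, eqxx, F).
by rewrite !(E, negbTE H1, negbTE H2, negbTE H3).
Qed.

Section Act.
Variable A : finType.
Notation X := (int -> A).
Variable Om : X -> Prop.
Hypothesis OmS : shift_invariant Om.

(* For [P] with [n.+1] disjoint levels, [tow P s] sends the point at level [i] of the
   tower over [u] to level [s u i]. *)
Definition tow n (P : X -> bool) (s : X -> 'S_n.+1) (x : X) : X :=
  if [pick i : 'I_n.+1 | P (sh (- i%:Z) x)] is Some i
  then sh ((s (sh (- i%:Z) x) i : nat)%:Z - i%:Z) x else x.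

Definition gam (P : X -> bool) := tow P (fun=> cyc3 2 0).

Section Fixed.
Variables (n : nat) (P : X -> bool).
Hypothesis sP : sep Om n.+1 P.
Implicit Types (s t : X -> 'S_n.+1).

Lemma sep_inj u v (i j : nat) : (i < n.+1)%N -> (j < n.+1)%N -> Om u -> P u -> P v ->
  sh i%:Z u = sh j%:Z v -> i = j /\ u = v.
Proof.
move=> Hi Hj Ou Pu Pv E.
have Ev : v = sh (i%:Z - j%:Z) u by rewrite -(shK j%:Z v) -E shD addrC.
have Ov : Om v by rewrite Ev (Om_sh OmS).
have Eu : u = sh (j%:Z - i%:Z) v by rewrite -(shK i%:Z u) E shD addrC.
case: (ltngtP i j) => H.
- by have /negP[] := sP Ov Pv (k := j%:Z - i%:Z) ltac:(lia); rewrite -Eu.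
- by have /negP[] := sP Ou Pu (k := i%:Z - j%:Z) ltac:(lia); rewrite -Ev.
- by split=> //; rewrite Ev H subrr sh0.
Qed.

Lemma tow_at s u (i : 'I_n.+1) : Om u -> P u ->
  tow P s (sh i%:Z u) = sh (s u i : nat)%:Z u.
Proof.
move=> Ou Pu; rewrite /tow; case: pickP => [j Hj|/(_ i)]; last by rewrite shK Pu.
have [|E1 E2] := sep_inj (ltn_ord i) (ltn_ord j) Ou Pu Hj; first by rewrite shKV.
rewrite -E2; have -> : j = i by apply: val_inj.
by rewrite shD subrK.
Qed.

Lemma tow_out s x : (forall i : 'I_n.+1, ~~ P (sh (- i%:Z) x)) -> tow P s x = x.
Proof. by move=> H; rewrite /tow; case: pickP => // j Hj; have := H j; rewrite Hj. Qed.

Lemma tow_ind (Q : X -> Prop) :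
  (forall u (i : 'I_n.+1), Om u -> P u -> Q (sh i%:Z u)) ->
  (forall x, Om x -> (forall i : 'I_n.+1, ~~ P (sh (- i%:Z) x)) -> Q x) ->
  forall x, Om x -> Q x.
Proof.
move=> H1 H2 x Ox; case: (pickP (fun i : 'I_n.+1 => P (sh (- i%:Z) x))) => [i Hi|H].
  by rewrite -(shKV i%:Z x); apply: H1 => //; rewrite (Om_sh OmS).
by apply: H2 => // i; rewrite H.
Qed.

Lemma tow_char F s :
  (forall u (i : 'I_n.+1), Om u -> P u -> F (sh i%:Z u) = sh (s u i : nat)%:Z u) ->
  (forall x, Om x -> (forall i : 'I_n.+1, ~~ P (sh (- i%:Z) x)) -> F x = x) ->
  forall x, Om x -> F x = tow P s x.
Proof.
move=> H1 H2; apply: tow_ind => [u i Ou Pu|x Ox Hx]; first by rewrite H1 // tow_at.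
by rewrite H2 // tow_out.
Qed.

Lemma tow_ext s t : (forall u, Om u -> P u -> s u = t u) ->
  forall x, Om x -> tow P s x = tow P t x.
Proof.
move=> E; apply: tow_char => [u i Ou Pu|x _]; first by rewrite tow_at // E.
exact: tow_out.
Qed.

Lemma tow_id s : (forall u, Om u -> P u -> s u = 1%g) ->
  forall x, Om x -> tow P s x = x.
Proof.
move=> E; apply: tow_ind => [u i Ou Pu|x _]; last exact: tow_out.
by rewrite tow_at // E // perm1.
Qed.

Lemma Om_tow s x : Om x -> Om (tow P s x).
Proof.
move=> Ox; rewrite /tow; case: pickP => // i _; by rewrite (Om_sh OmS).
Qed.

Lemma towM s t x : Om x ->
  tow P t (tow P s x) = tow P (fun u => s u * t u)%g x.
Proof.
move: x; apply: tow_char => [u i Ou Pu|x _ Hx]; first by rewrite !tow_at // permM.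
by rewrite (tow_out s) // tow_out.
Qed.

Lemma tow_inv s : inverse_on Om (tow P s) (tow P (fun u => (s u)^-1%g)).
Proof.
split=> x Ox; rewrite towM // tow_id // => u _ _; by rewrite ?mulgV ?mulVg.
Qed.

Lemma tow_cocycle s : lc Om P -> lc Om s ->
  exists2 f : X -> int, lc Om f & forall x, Om x -> tow P s x = sh (f x) x.
Proof.
move=> lP ls.
pose f x : int := let g := [ffun i : 'I_n.+1 => P (sh (- i%:Z) x)] in
  let t := [ffun i : 'I_n.+1 => s (sh (- i%:Z) x)] in
  if [pick i : 'I_n.+1 | g i] is Some i then (t i i : nat)%:Z - i%:Z else 0.
exists f => [|x Ox].
  apply: (lc_map2 (fun (g : {ffun 'I_n.+1 -> bool}) (t : {ffun 'I_n.+1 -> 'S_n.+1}) =>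
    if [pick i : 'I_n.+1 | g i] is Some i then (t i i : nat)%:Z - i%:Z else 0)).
    by apply: lc_ffun => i; apply: lc_sh.
  by apply: (lc_ffun (F := fun (i : 'I_n.+1) x => s (sh (- i%:Z) x))) => i; apply: lc_sh.
have E : (fun i : 'I_n.+1 => [ffun i : 'I_n.+1 => P (sh (- i%:Z) x)] i) =1
    (fun i => P (sh (- i%:Z) x)) by move=> i; rewrite ffunE.
rewrite /tow /f /= (eq_pick E).
by case: pickP => [i _|_]; rewrite ?ffunE ?sh0.
Qed.

End Fixed.

Lemma gam_gam (P : X -> bool) : sep Om 3 P -> inverse_on Om (gam P) (fun x => gam P (gam P x)).
Proof.
move=> sP; suff H x : Om x -> gam P (gam P (gam P x)) = x by split=> x Ox; apply: H.
move=> Ox; rewrite /gam !(towM sP) //; last by apply: Om_tow.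
by apply: (tow_id sP) => // _ _ _; apply: cyc3_cube.
Qed.

Lemma in_GTI F G (f g : X -> int) : lc Om f -> lc Om g ->
  (forall x, Om x -> F x = sh (f x) x) -> (forall x, Om x -> G x = sh (g x) x) ->
  inverse_on Om F G -> in_GT Om F.
Proof.
have C H (h : X -> int) : lc Om h -> (forall x, Om x -> H x = sh (h x) x) ->
    maps_into Om H /\ cont_on Om H.
  move=> [n Hn] E; split=> [x Ox|x Ox m]; first by rewrite E // (Om_sh OmS).
  exists (maxn n (m + absz (h x))) => y Oy Hxy.
  have Eh : h y = h x by rewrite (Hn x y) //; apply: agreeW Hxy; lia.
  by rewrite !E // Eh; apply: agree_sh; apply: agreeW Hxy; lia.
move=> lf lg Ef Eg FG.
have [mF cF] := C _ _ lf Ef; have [mG cG] := C _ _ lg Eg.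
split; first by split=> //; exists G.
exists f; split=> //; case: lf => n Hn x Ox; exists n => y Oy Hxy.
by rewrite (Hn x y).
Qed.

Lemma in_GT_tow n (P : X -> bool) (s : X -> 'S_n.+1) :
  sep Om n.+1 P -> lc Om P -> lc Om s -> in_GT Om (tow P s).
Proof.
move=> sP lP ls; have [f lf Ef] := tow_cocycle lP ls.
have [|g lg Eg] := @tow_cocycle n P (fun u => (s u)^-1%g) lP.
  exact: lc_map.
exact: in_GTI lf lg Ef Eg (tow_inv sP s).
Qed.

Lemma in_GT_ext F G : (forall x, Om x -> F x = G x) -> in_GT Om F -> in_GT Om G.
Proof.
move=> E [[mF cF [F' [mF' cF' [H1 H2]]]] [f [cf Ef]]]; split; last first.
  by exists f; split=> // x Ox; rewrite -E // Ef.
split; first by move=> x Ox; rewrite -E //; apply: mF.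
  move=> x Ox n; have [m Hm] := cF x Ox n; exists m => y Oy Hxy.
  by rewrite -!E //; apply: Hm.
exists F'; split=> //; split=> x Ox; rewrite -E ?H1 ?H2 //; exact: mF'.
Qed.

Hypothesis OmC : closed_set Om.

Lemma in_GTE F : in_GT Om F -> exists G (f g : X -> int), [/\ lc Om f, lc Om g,
  forall x, Om x -> F x = sh (f x) x, forall x, Om x -> G x = sh (g x) x &
  inverse_on Om F G].
Proof.
move=> [[mF cF [G [mG cG [H1 H2]]]] [f [cf Ef]]].
exists G, f, (fun x => - f (G x)); split=> //; first exact: cont_lc.
  apply: cont_lc => // x Ox; have [m Hm] := cf _ (mG x Ox); have [k Hk] := cG x Ox m.
  exists k => y Oy Hxy; rewrite Hm //; [exact: mG | exact: Hk].
move=> x Ox; have E := Ef _ (mG x Ox); rewrite H2 // in E.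
by rewrite {3}E shK.
Qed.

Lemma in_GT_comp F F' : in_GT Om F -> in_GT Om F' -> in_GT Om (fun x => F (F' x)).
Proof.
move=> /in_GTE [G [f [g [lf lg Ef Eg [H1 H2]]]]] /in_GTE [G' [f' [g' [lf' lg' Ef' Eg' [H1' H2']]]]].
have O k x : Om x -> Om (sh k x) by move=> Ox; rewrite (Om_sh OmS).
apply: (@in_GTI _ (fun x => G' (G x)) (fun x => f (sh (f' x) x) + f' x)
  (fun x => g' (sh (g x) x) + g x)).
- by apply: lc_map2 => //; apply: lc_shv.
- by apply: lc_map2 => //; apply: lc_shv.
- by move=> x Ox; rewrite Ef' // Ef ?shD //; apply: O.
- by move=> x Ox; rewrite Eg // Eg' ?shD //; apply: O.
split=> x Ox.
  by rewrite H1 ?H1' // Ef' //; apply: O.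
by rewrite H2' ?H2 // Eg //; apply: O.
Qed.

Lemma in_GT_inv F G : in_GT Om F -> inverse_on Om F G -> in_GT Om G.
Proof.
move=> /in_GTE [G' [f [g [lf lg Ef Eg [H1' H2']]]]] [H1 H2].
have O k x : Om x -> Om (sh k x) by move=> Ox; rewrite (Om_sh OmS).
have E x : Om x -> G' x = G x.
  by move=> Ox; rewrite -{2}(H2' x Ox) H1 // Eg //; apply: O.
apply: (in_GT_ext E); exact: in_GTI lg lf Eg Ef (conj H2' H1').
Qed.

Lemma in_GT_maps F : in_GT Om F -> maps_into Om F.
Proof. by case=> [[]]. Qed.

(** The generated monoid, up to equality on [Om]. It is only used for 3-cycles, whose inverses are
    their squares, so it is the generated group. *)
Inductive gen (S : (X -> X) -> Prop) : (X -> X) -> Prop :=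
| gen_id F : (forall x, Om x -> F x = x) -> gen S F
| gen_step g F F' : S g -> maps_into Om g -> gen S F ->
    (forall x, Om x -> F' x = g (F x)) -> gen S F'.

Lemma gen_maps S F : gen S F -> maps_into Om F.
Proof.
elim=> [F' E x Ox|g F1 F' _ mg _ IH E x Ox]; rewrite E //; apply: mg; exact: IH.
Qed.

Lemma gen_ext S F G : (forall x, Om x -> F x = G x) -> gen S F -> gen S G.
Proof.
move=> E gF; case: gF E => [F' E' E|g F1 F' Sg mg gF E' E].
  by apply: gen_id => x Ox; rewrite -E // E'.
by apply: (gen_step Sg mg gF) => x Ox; rewrite -E // E'.
Qed.

Lemma gen_comp S F G : gen S F -> gen S G -> gen S (fun x => F (G x)).
Proof.
move=> gF gG; have mG := gen_maps gG; elim: gF => [F' E|g F1 F' Sg mg _ IH E].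
  by apply: gen_ext gG => x Ox; rewrite E //; apply: mG.
by apply: (gen_step Sg mg IH) => x Ox; rewrite E //; apply: mG.
Qed.

Lemma gen_base (S : (X -> X) -> Prop) g : S g -> maps_into Om g -> gen S g.
Proof. by move=> Sg mg; apply: (gen_step Sg mg (gen_id S (F := id) (fun _ _ => erefl))). Qed.

Lemma gen_sub (S S' : (X -> X) -> Prop) F : (forall g, S g -> gen S' g) -> gen S F -> gen S' F.
Proof.
move=> H; elim=> [F' E|g F1 F' Sg mg _ IH E]; first exact: gen_id.
by apply: gen_ext (gen_comp (H _ Sg) IH) => x Ox; rewrite E.
Qed.

Definition gammas (g : X -> X) := exists U, [/\ lc Om U, sep Om 3 U & g = gam U].
Definition alt := gen gammas.

Lemma sepW m n (P : X -> bool) : (m <= n)%N -> sep Om n P -> sep Om m P.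
Proof. move=> Hmn H x Ox Px k Hk; apply: H => //; lia. Qed.

Lemma sep_sub m (P Q : X -> bool) : (forall x, Om x -> P x -> Q x) -> sep Om m Q -> sep Om m P.
Proof.
move=> H HQ x Ox Px k Hk; have := HQ x Ox (H _ Ox Px) k Hk.
by apply: contra; apply: H; rewrite (Om_sh OmS).
Qed.

Lemma sep_sh m (P : X -> bool) a : sep Om m P -> sep Om m (fun x => P (sh a x)).
Proof.
move=> H x Ox Px k Hk; rewrite shD addrC -shD; apply: H => //.
by rewrite (Om_sh OmS).
Qed.

(** Seen inside a taller tower, 3-cycles based at different levels become permutations of one set of
    levels and can be multiplied there. *)
Lemma gam_embed n (W : X -> bool) (Q : X -> bool) k : (k.+1 < n)%N -> sep Om n.+1 W ->
  forall x, Om x -> gam (fun y => W (sh (- k%:Z) y) && Q (sh (- k%:Z) y)) x =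
    tow W (fun u => if Q u then cyc3 n k else 1%g) x.
Proof.
move=> Hk sW.
have sU : sep Om 3 (fun y => W (sh (- k%:Z) y) && Q (sh (- k%:Z) y)).
  apply: (@sep_sub _ _ (fun y => W (sh (- k%:Z) y))); first by move=> x _ /andP[].
  by apply: sep_sh; apply: sepW sW; lia.
apply: (tow_char sW) => [u i Ou Wu|x Ox Hx]; last first.
  apply: tow_out => j; apply/negP => /andP[Hj _]; rewrite shD in Hj.
  have Hj' : (k + j < n.+1)%N by have := ltn_ord j; lia.
  by have := Hx (Ordinal Hj') => /=; rewrite PoszD opprD Hj.
case: ifP => Qu; last first.
  rewrite perm1; apply: tow_out => j; apply/negP => /andP[Hj Qj].
  rewrite !shD in Hj Qj.
  have [||E1 E2] := @sep_inj n W sW u (sh (- k%:Z - j%:Z + i%:Z) u) i (k + j)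
    (ltn_ord i) _ Ou Wu Hj.
  - by have := ltn_ord j; lia.
  - by rewrite shD; congr (sh _ u); lia.
  by rewrite -E2 Qu in Qj.
rewrite cyc3E //.
case: (boolP (k <= i < k.+3)%N) => Hi; last first.
  have -> : (if i == k :> nat then k.+1 else if i == k.+1 :> nat then k.+2
     else if i == k.+2 :> nat then k else i) = i by do !case: eqP => ? //; lia.
  apply: tow_out => j; apply/negP => /andP[Hj Qj].
  rewrite !shD in Hj Qj.
  have [||E1 E2] := @sep_inj n W sW u (sh (- k%:Z - j%:Z + i%:Z) u) i (k + j)
    (ltn_ord i) _ Ou Wu Hj.
  - by have := ltn_ord j; lia.
  - by rewrite shD; congr (sh _ u); lia.
  by have := ltn_ord j; lia.
have Hi' : (i - k < 3)%N by lia.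
have -> : i%:Z = (Ordinal Hi')%:Z + k%:Z by rewrite /=; lia.
rewrite -shD /gam tow_at //; last by rewrite shK Wu Qu.
  rewrite shD cyc3E //=; congr (sh _ u); do !case: eqP => ? //; lia.
by rewrite (Om_sh OmS).
Qed.

End Act.

(** * The commutator subgroup is generated by 3-cycles *)

Section Alt.
Variable A : finType.
Notation X := (int -> A).
Variable Om : X -> Prop.
Hypothesis OmS : shift_invariant Om.

Section Const.
Variables (n : nat) (P : X -> bool).
Hypotheses (sP : sep Om n.+1 P) (lP : lc Om P).
Let a (s : 'S_n.+1) := alt Om (tow P (fun=> s)).

Lemma alt1 : a 1%g.
Proof. by apply: gen_id => x Ox; apply: (tow_id OmS sP). Qed.

Lemma altM s t : a s -> a t -> a (s * t)%g.
Proof.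
move=> Hs Ht; apply: gen_ext (gen_comp Ht Hs) => x Ox.
by rewrite (towM OmS sP).
Qed.

Lemma altV s : a s -> a (s^-1)%g.
Proof.
move=> Hs; rewrite invg_expg; elim: (#[s]%g.-1) => [|m IH]; first exact: alt1.
by rewrite expgS; apply: altM.
Qed.

Lemma alt_cyc3 k : (k.+1 < n)%N -> a (cyc3 n k).
Proof.
move=> Hk.
pose U (y : X) := P (sh (- k%:Z) y) && true.
apply: (@gen_ext _ _ _ (gam U)).
  by move=> x Ox; rewrite (gam_embed OmS (fun=> true) Hk sP).
apply: gen_base.
  exists U; split=> //.
    by apply: lc_map2 (lc_const _ _); apply: lc_sh.
  apply: (sep_sub OmS (Q := fun x => P (sh (- k%:Z) x))); first by move=> x _ /andP[].
  by apply: sep_sh => //; apply: sepW sP; lia.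
by move=> x Ox; apply: Om_tow.
Qed.

Lemma adj2 k : (adj n k * adj n k)%g = 1%g.
Proof. exact: tperm2. Qed.

(** Telescoping: neighbouring adjacent transpositions multiply to a [cyc3], and each inserted
    transposition cancels with itself. *)
Lemma alt_adj_adj i j : (i < n)%N -> (j < n)%N -> a (adj n i * adj n j)%g.
Proof.
have lt i' d : (i' + d < n)%N -> a (adj n (i' + d) * adj n i')%g.
  elim: d => [|d IH] Hd; first by rewrite addn0 adj2; apply: alt1.
  have -> : (adj n (i' + d.+1) * adj n i' =
     (adj n (i' + d.+1) * adj n (i' + d)) * (adj n (i' + d) * adj n i'))%g.
    by rewrite mulgA -[(_ * _ * adj n (i' + d))%g]mulgA adj2 mulg1.
  apply: altM; last by apply: IH; lia.
  by rewrite addnS; apply: alt_cyc3; lia.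
move=> Hi Hj; case: (leqP j i) => H; first by rewrite -(subnKC H); apply: lt; lia.
have -> : (adj n i * adj n j = (adj n j * adj n i)^-1)%g by rewrite invMg !tpermV.
by apply: altV; rewrite -(subnKC (ltnW H)); apply: lt; lia.
Qed.

(* Adjacent transpositions act on the odd coset through [adj n 0]. *)
Let good (s : 'S_n.+1) := if odd_perm s then a (adj n 0 * s)%g else a s.

Lemma good_adj k s : (k < n)%N -> good s -> good (adj n k * s)%g.
Proof.
move=> Hk; rewrite /good odd_permM.
have -> : odd_perm (adj n k) = true.
  rewrite odd_tperm; apply/eqP => /(congr1 val) /=; rewrite !inordK; lia.
have H0 : (0 < n)%N by lia.
case: (odd_perm s) => /= Hs.
  have -> : (adj n k * s = (adj n k * adj n 0) * (adj n 0 * s))%g.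
    by rewrite mulgA -[(_ * _ * adj n 0)%g]mulgA adj2 mulg1.
  by apply: altM => //; apply: alt_adj_adj.
by rewrite mulgA; apply: altM => //; apply: alt_adj_adj.
Qed.

Lemma good_tperm (i j : 'I_n.+1) s : i != j -> good s -> good (tperm i j * s)%g.
Proof.
have lt d (k : 'I_n.+1) t : (k + d.+1 < n.+1)%N -> good t ->
    good (tperm k (inord (k + d.+1)) * t)%g.
  elim: d t => [|d IH] t Hd Ht.
    have -> : tperm k (inord (k + 1)) = adj n k by rewrite /adj inord_val addn1.
    by apply: good_adj => //; lia.
  (* A transposition of distant levels is a shorter one conjugated by an adjacent transposition. *)
  have -> : tperm k (inord (k + d.+2)) =
    (adj n (k + d.+1) * tperm k (inord (k + d.+1)) * adj n (k + d.+1))%g.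
    have -> : (adj n (k + d.+1) * tperm k (inord (k + d.+1)) * adj n (k + d.+1) =
      tperm k (inord (k + d.+1)) ^ adj n (k + d.+1))%g.
      by rewrite conjgE tpermV mulgA.
    rewrite tpermJ; congr (tperm _ _); apply: val_inj.
      by rewrite /= adjE; do ?(case: eqP => ?); lia.
    by rewrite /= adjE; [rewrite !inordK; try lia; rewrite eqxx addnS | lia].
  rewrite -!mulgA; apply: good_adj; first by lia.
  by apply: IH; [lia | apply: good_adj => //; lia].
move=> Hij Hs.
have [H|H|/val_inj H] := ltngtP i j; last by rewrite H eqxx in Hij.
- have -> : j = inord (i + (j - i.+1).+1).
    by apply: val_inj; rewrite /= inordK; have := ltn_ord j; lia.
  by apply: lt => //; have := ltn_ord j; lia.
- rewrite tpermC; have -> : i = inord (j + (i - j.+1).+1).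
    by apply: val_inj; rewrite /= inordK; have := ltn_ord i; lia.
  by apply: lt => //; have := ltn_ord i; lia.
Qed.

Lemma alt_even_const s : ~~ odd_perm s -> a s.
Proof.
suff : good s by rewrite /good; case: odd_perm.
have [ts -> Hts] := prod_tpermP s; elim: ts Hts => [|[i j] ts IH] /=.
  by rewrite big_nil /good odd_perm1 => _; apply: alt1.
by case/andP => Hij /IH H; rewrite big_cons; apply: good_tperm.
Qed.

(** Towers over disjoint pieces of the base act on disjoint sets, so the whole is the product over
    the values of [phi]. *)
Lemma gen_split S (T : finType) (phi : X -> T) (s : X -> 'S_n.+1) :
  (forall t, gen Om S (tow P (fun u => if phi u == t then s u else 1%g))) ->
  gen Om S (tow P s).
Proof.
move=> H.
suff Hl (l : seq T) : uniq l ->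
    gen Om S (tow P (fun u => if phi u \in l then s u else 1%g)).
  apply: gen_ext (Hl (enum T) (enum_uniq T)) => x Ox.
  by apply: (tow_ext OmS sP) => // u _ _; rewrite mem_enum.
elim: l => [_|t l IH /= /andP[Ht Hl]].
  by apply: gen_id => x Ox; apply: (tow_id OmS sP).
apply: gen_ext (gen_comp (IH Hl) (H t)) => x Ox.
rewrite (towM OmS sP) //; apply: (tow_ext OmS sP) => // u _ _.
rewrite inE; case: eqP => [->|_]; rewrite ?mul1g //=.
by rewrite (negbTE Ht) mulg1.
Qed.

Lemma tow_restrict (b : X -> bool) (s : X -> 'S_n.+1) x : Om x ->
  tow P (fun u => if b u then s u else 1%g) x = tow (fun u => P u && b u) s x.
Proof.
have sP' : sep Om n.+1 (fun u => P u && b u).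
  by apply: (sep_sub OmS (Q := P)) => // y _ /andP[].
move=> Ox; symmetry; move: x Ox.
apply: (tow_char OmS sP) => [u i Ou Pu|x Ox Hx]; last first.
  by apply: tow_out => i; rewrite negb_and Hx.
case: (boolP (b u)) => [bu|nbu]; first by rewrite (tow_at OmS sP') // Pu.
rewrite perm1; apply: tow_out => j; apply/negP => Hj.
have [||_ E] := @sep_inj _ _ OmS n P sP u (sh (- j%:Z) (sh i%:Z u)) i j
  (ltn_ord i) (ltn_ord j) Ou Pu.
- by case/andP: Hj.
- by rewrite shKV.
by case/andP: Hj; rewrite -E (negbTE nbu).
Qed.

End Const.

(** Splitting the base by the value of [s] reduces to constant permutations; odd values do not occur
    over the base and give the identity. *)
Lemma alt_even n (P : X -> bool) (s : X -> 'S_n.+1) :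
  sep Om n.+1 P -> lc Om P -> lc Om s ->
  (forall u, Om u -> P u -> ~~ odd_perm (s u)) -> alt Om (tow P s).
Proof.
move=> sP lP ls Hs; apply: (gen_split sP (phi := s)) => t.
have [ot|et] := boolP (odd_perm t).
  apply: gen_id => x Ox; apply: (tow_id OmS sP) => // u Ou Pu.
  by case: eqP => // E; have := Hs u Ou Pu; rewrite E ot.
have sP' : sep Om n.+1 (fun u => P u && (s u == t)).
  by apply: (sep_sub OmS (Q := P)) => // x _ /andP[].
have lP' : lc Om (fun u => P u && (s u == t)).
  by apply: lc_map2 => //; apply: (lc_map (fun r => r == t)).
apply: gen_ext (alt_even_const sP' lP' et) => x Ox.
rewrite (tow_restrict sP) //; apply: (tow_ext OmS sP') => // u _ /andP[_ /eqP ->] //.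
Qed.

End Alt.

(** For distinct points, the cycle [a -> b -> c -> a]. *)
Definition tri n (a b c : 'I_n.+1) : 'S_n.+1 := (tperm b c * tperm a b)%g.

Section Tri.
Variables (n : nat) (a b c : 'I_n.+1).
Hypotheses (ab : a != b) (bc : b != c) (ac : a != c).

Lemma tri1 : tri a b c a = b.
Proof. by rewrite /tri permM (tpermD (z := a)) 1?eq_sym // tpermL. Qed.

Lemma tri2 : tri a b c b = c.
Proof. by rewrite /tri permM tpermL tpermD. Qed.

Lemma tri3 : tri a b c c = a.
Proof. by rewrite /tri permM tpermR tpermR. Qed.

Lemma triD i : i != a -> i != b -> i != c -> tri a b c i = i.
Proof. by move=> ia ib ic; rewrite /tri permM !tpermD // eq_sym. Qed.

Lemma odd_tri : odd_perm (tri a b c) = false.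
Proof. by rewrite /tri odd_permM !odd_tperm ab bc. Qed.
End Tri.

(** * Normality of the group generated by 3-cycles *)

Section Conj.
Variable A : finType.
Notation X := (int -> A).
Variable Om : X -> Prop.
Hypotheses (OmS : shift_invariant Om) (OmC : closed_set Om).
Hypothesis aper : forall x k, Om x -> sh k x = x -> k = 0.

Definition small_gammas N (g : X -> X) := exists U, [/\ lc Om U, sep Om N U & g = gam U].

(** Cutting the base along long windows makes every piece as separated as desired, which is the room
    that conjugation consumes. *)
Lemma alt_small N F : (3 <= N)%N -> alt Om F -> gen Om (small_gammas N) F.
Proof.
move=> HN; apply: gen_sub => _ [U [lU sU ->]].
have [n Hn] := sep_win OmC aper N.
apply: (gen_split OmS sU (phi := win n)) => w.
have sU' : sep Om N (fun u => U u && (win n u == w)).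
  by apply: (sep_sub OmS (Q := fun u => win n u == w)) => // y _ /andP[].
apply: (@gen_ext _ _ _ (gam (fun u => U u && (win n u == w)))).
  by move=> x Ox; rewrite (tow_restrict OmS sU).
apply: gen_base; last by move=> x Ox; apply: Om_tow.
exists (fun u => U u && (win n u == w)); split=> //.
by apply: lc_map2 => //; apply: (lc_map (fun r => r == w)); apply: lc_win.
Qed.

(** Since [g] moves points by at most [M], it sends the three levels over a point of [U] to places
    between [- M] and [M + 2]. These are the [2 * M + 3] levels of a tower over [P], the translate
    of [U] by [M], and the conjugate permutes them by the 3-cycle of the images, which is even. *)
Lemma alt_conj_small g gi (f : X -> int) (M : nat) U : lc Om f ->
  (forall x, Om x -> g x = sh (f x) x) -> (forall x, Om x -> (absz (f x) <= M)%N) ->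
  maps_into Om gi -> inverse_on Om g gi ->
  lc Om U -> sep Om (2 * M).+3 U -> alt Om (fun x => g (gam U (gi x))).
Proof.
move=> lf Ef HM mgi [H1 H2] lU sU.
have O k x : Om x -> Om (sh k x) by move=> Ox; rewrite (Om_sh OmS).
have g_inj x y : Om x -> Om y -> g x = g y -> x = y.
  by move=> Ox Oy E; rewrite -(H1 x Ox) E H1.
have sU3 : sep Om 3 U by apply: sepW sU; lia.
pose P x := U (sh M%:Z x).
have sP : sep Om (2 * M).+3 P by apply: sep_sh.
pose pz (j : nat) v : int := M%:Z + j%:Z + f (sh j%:Z (sh M%:Z v)).
pose p (j : nat) v : 'I_(2 * M).+3 := inord (absz (pz j v)).
have pE j v : (j < 3)%N -> Om v -> (p j v : nat)%:Z = pz j v.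
  move=> Hj Ov; have := HM _ (O j%:Z _ (O M%:Z _ Ov)); rewrite /p /pz => Hf.
  by rewrite inordK; lia.
have gE (j : nat) v : (j < 3)%N -> Om v -> g (sh j%:Z (sh M%:Z v)) = sh (p j v : nat)%:Z v.
  move=> Hj Ov; rewrite Ef; last exact: (O _ _ (O _ _ Ov)).
  rewrite pE // /pz !shD; congr (sh _ v); lia.
have p_inj i j v : (i < 3)%N -> (j < 3)%N -> Om v -> P v -> p i v = p j v -> i = j.
  move=> Hi Hj Ov Pv E; have := gE i v Hi Ov; rewrite E -(gE j) // => /g_inj Eg.
  have [|-> //] := @sep_inj _ _ OmS 2 U sU3 (sh M%:Z v) (sh M%:Z v) i j Hi Hj (O _ _ Ov) Pv Pv.
  by apply: Eg; exact: (O _ _ (O _ _ Ov)).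
pose s v : 'S_(2 * M).+3 := tri (p 0 v) (p 1 v) (p 2 v).
have N01 v : Om v -> P v -> p 0 v != p 1 v.
  by move=> Ov Pv; apply/eqP => /p_inj; move/(_ isT isT Ov Pv).
have N12 v : Om v -> P v -> p 1 v != p 2 v.
  by move=> Ov Pv; apply/eqP => /p_inj; move/(_ isT isT Ov Pv).
have N02 v : Om v -> P v -> p 0 v != p 2 v.
  by move=> Ov Pv; apply/eqP => /p_inj; move/(_ isT isT Ov Pv).
have lp j : lc Om (p j).
  apply: (lc_map (fun z : int => inord (absz (M%:Z + j%:Z + z)) : 'I_(2 * M).+3)
    (f := fun v => f (sh j%:Z (sh M%:Z v)))).
  apply: (lc_sh OmS (f := fun v => f (sh j%:Z v))); exact: lc_sh.
have aS : alt Om (tow P s).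
  apply: alt_even => //.
  - exact: lc_sh.
  - exact: (lc_map2 (fun a bc => tri a bc.1 bc.2) (lp 0) (lc_map2 pair (lp 1) (lp 2))).
  - by move=> u Ou Pu; rewrite odd_tri ?N01 ?N12.
suff H y : Om y -> g (gam U y) = tow P s (g y).
  by apply: gen_ext aS => x Ox; rewrite H ?H2 //; apply: mgi.
move: y; apply: (tow_ind OmS (P := U) (n := 2)) => [u i Ou Uu|y Oy Hy].
  rewrite /gam (tow_at OmS sU3) //.
  pose v := sh (- M%:Z) u; have Ov : Om v by apply: O.
  have Ev : u = sh M%:Z v by rewrite shKV.
  have Pv : P v by rewrite /P -Ev.
  rewrite {2}Ev gE // (tow_at OmS sP) // Ev gE //; congr (sh (Posz _) v).
  rewrite cyc3E // /s.
  case: i => [[|[|[|//]]] Hi] /=.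
  - by rewrite tri1 ?N01 ?N12 ?N02.
  - by rewrite tri2 ?N01 ?N12 ?N02.
  - by rewrite tri3 ?N01 ?N12 ?N02.
rewrite /gam tow_out //.
case: (pickP (fun i : 'I_(2 * M).+3 => P (sh (- i%:Z) (g y)))) => [i Hi|Hno]; last first.
  by rewrite tow_out // => i; rewrite Hno.
set v := sh _ _ in Hi; have Ov : Om v by rewrite /v Ef //; exact: (O _ _ (O _ _ Oy)).
have Eg : g y = sh i%:Z v by rewrite shKV.
have Np j : (j < 3)%N -> i != p j v.
  move=> Hj; apply/eqP => Ei; have := Hy (Ordinal Hj) => /=.
  have -> : y = sh j%:Z (sh M%:Z v)
    by apply: g_inj => //; [exact: (O _ _ (O _ _ Ov)) | rewrite gE // Eg Ei].
  by rewrite shK; move/negP; apply.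
by rewrite Eg (tow_at OmS sP) // /s triD // Np.
Qed.

Lemma alt_conj g gi F : in_GT Om g -> inverse_on Om g gi -> alt Om F ->
  alt Om (fun x => g (F (gi x))).
Proof.
move=> Gg Ig aF; have mgi := in_GT_maps (in_GT_inv OmS OmC Gg Ig).
have [_ [f [_ [lf _ Ef _ _]]]] := in_GTE OmC Gg.
have [M HM] := lc_bounded lf.
have := alt_small (N := (2 * M).+3) isT aF.
elim=> [F' E|g1 F1 F' [U [lU sU ->]] mg gF IH E].
  by apply: gen_id => x Ox; rewrite E ?(proj2 Ig) //; apply: mgi.
have H := alt_conj_small lf Ef HM mgi Ig lU sU.
apply: gen_ext (gen_comp H IH) => x Ox.
have OF1 : Om (F1 (gi x)) by apply: (gen_maps gF); apply: mgi.
by rewrite (proj1 Ig) // E //; apply: mgi.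
Qed.

End Conj.

(** * Commutators are products of 3-cycles *)

Section Derived.
Variable A : finType.
Notation X := (int -> A).
Variable Om : X -> Prop.
Hypotheses (OmS : shift_invariant Om) (OmC : closed_set Om).
Hypothesis aper : forall x k, Om x -> sh k x = x -> k = 0.

Let O k x : Om x -> Om (sh k x).
Proof. by move=> Ox; rewrite (Om_sh OmS). Qed.

Lemma in_GT_inj F x y : in_GT Om F -> Om x -> Om y -> F x = F y -> x = y.
Proof.
move=> [[_ _ [G [_ _ [H _]]]] _] Ox Oy E.
by rewrite -(H x Ox) E H.
Qed.

Lemma alt_GT F : alt Om F -> in_GT Om F.
Proof.
elim=> [F' E|g F1 F' [U [lU sU ->]] _ _ IH E].
  have E0 x : Om x -> F' x = sh 0 x by move=> Ox; rewrite E // sh0.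
  have E1 x : Om x -> id x = sh 0 x by rewrite sh0.
  have I : inverse_on Om F' id by split=> x Ox; rewrite /= E.
  exact: (in_GTI OmS (lc_const Om 0) (lc_const Om 0) E0 E1 I).
apply: (in_GT_ext _ (in_GT_comp OmS OmC (in_GT_tow OmS sU lU (lc_const _ (cyc3 2 0))) IH)).
by move=> x Ox; rewrite E.
Qed.

Section Sort.
Variables (g : X -> X) (f : X -> int) (M : nat) (U : X -> bool).
Hypotheses (gG : in_GT Om g) (gE : forall x, Om x -> g x = sh (f x) x).
Hypotheses (fM : forall x, Om x -> (absz (f x) <= M)%N) (lU : lc Om U).

(* Markers such that the next marker is more than [M] beyond position [j]. *)
Let D j u := U u && [forall i : 'I_(j + M), ~~ U (sh (i.+1)%:Z u)].

Lemma D_marker j u : D j u -> U u.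
Proof. by case/andP. Qed.

Lemma D_gap j u k : D j u -> 0 < k <= j%:Z + M%:Z -> ~~ U (sh k u).
Proof.
case/andP => _ /forallP H Hk; have Hi : (absz (k - 1)%R < j + M)%N by lia.
by have := H (Ordinal Hi) => /=; have -> : (absz (k - 1)%R).+1%:Z = k by lia.
Qed.

Lemma lc_D j : lc Om (D j).
Proof.
apply: lc_map2 => //.
apply: (lc_eq (f := fun x => ~~ [exists i : 'I_(j + M), U (sh (i.+1)%:Z x)])).
  by move=> x _; rewrite negb_exists.
by apply: (lc_map negb); apply: lc_ex => i; apply: lc_sh.
Qed.

Lemma sep_D j : sep Om (j + M).+1 (D j).
Proof.
move=> x Ox Dx k Hk; apply/negP => /D_marker; apply/negP.
by apply: (D_gap Dx); lia.
Qed.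

(* The bound in the last clause keeps the cycles over distinct markers disjoint. *)
Let sorted_upto j h := [/\ in_GT Om h,
  forall (i : nat) u, (M.+2 <= i < j)%N -> Om u -> D i u -> h (sh i%:Z u) = sh i%:Z u &
  forall (m : nat) u, (j <= m)%N -> Om u -> D m u ->
    exists2 s : nat, (s <= m + M)%N & h (sh m%:Z u) = sh s%:Z u].

(* If [h] sends level [j] to level [p], apply the 3-cycle [p -> j -> t -> p] with [t]
   one of the two lowest levels. *)
Lemma sort_step j h : (M.+2 <= j)%N -> sorted_upto j h ->
  exists2 al, alt Om al & sorted_upto j.+1 (fun x => al (h x)).
Proof.
move=> Hj [hG h2 h3].
have [_ [fh [_ [lfh _ hE _ _]]]] := in_GTE OmC hG.
pose n := (j + M)%N.
pose p u : 'I_n.+1 := inord (absz (j%:Z + fh (sh j%:Z u))).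
have pE u : Om u -> D j u -> h (sh j%:Z u) = sh (p u : nat)%:Z u.
  move=> Ou Du; have [s Hs Es] := h3 j u (leqnn j) Ou Du; rewrite Es.
  have : s%:Z = j%:Z + fh (sh j%:Z u).
    apply: (sh_inj OmS aper Ou); rewrite -Es hE ?shD; last exact: O.
    by congr (sh _ u); lia.
  by rewrite /p => <-; rewrite inordK.
pose J : 'I_n.+1 := inord j.
have JE : J = j :> nat by rewrite inordK // /n; lia.
pose t u : 'I_n.+1 := inord (if p u == 0 :> nat then 1 else 0).
have tE u : t u = (if p u == 0 :> nat then 1 else 0) :> nat.
  by rewrite inordK //; case: ifP => _; rewrite /n; lia.
pose s u : 'S_n.+1 := if p u == J then 1%g else tri (p u) J (t u).
have Ntp u : p u != t u by rewrite -val_eqE /= tE; case: (nat_of_ord (p u)) => [|[]].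
have NtJ u : J != t u by rewrite -val_eqE /= tE JE; case: ifP => _; lia.
have sD := @sep_D j; have lD := lc_D j.
have ls : lc Om s.
  have lp : lc Om p.
    apply: (lc_map (fun z : int => inord (absz (j%:Z + z)) : 'I_n.+1)
      (f := fun u => fh (sh j%:Z u))); exact: lc_sh.
  by apply: (lc_map (fun q : 'I_n.+1 => if q == J then 1%g : 'S_n.+1 else
    tri q J (inord (if q == 0 :> nat then 1 else 0)))).
have aal : alt Om (tow (D j) s).
  apply: alt_even => // u Ou Du; rewrite /s; case: eqP => [_|/eqP H].
    by rewrite odd_perm1.
  by rewrite odd_tri ?H.
exists (tow (D j) s) => //; split.
- exact: (in_GT_comp OmS OmC (alt_GT aal) hG).
- move=> i u Hi Ou Du; case: (ltngtP i j) => Hij; last 1 first.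
  + rewrite Hij in Du *; rewrite pE // (tow_at OmS sD) // /s; congr (sh (Posz _) u).
    case: (eqVneq (p u) J) => [E|H]; first by rewrite perm1 E JE.
    by rewrite tri1 ?JE // eq_sym.
  + rewrite h2 //; last by lia.
    case: (pickP (fun q : 'I_n.+1 => D j (sh (- q%:Z) (sh i%:Z u)))) => [q Hq|Hno]; last first.
      by rewrite tow_out // => q; rewrite Hno.
    set v := sh _ _ in Hq; have Ov : Om v by do 2 apply: O.
    have Ev : sh i%:Z u = sh q%:Z v by rewrite shKV.
    rewrite Ev (tow_at OmS sD) // /s; congr (sh (Posz _) v).
    case: (eqVneq (p v) J) => [_|H]; first by rewrite perm1.
    (* The sorted point must avoid the cycle over [v]. Being at level [p v] contradicts injectivity
       of [h]; being at level [J] puts the marker [u] in the gap of [v], and at level [t v] the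
       marker [v] in the gap of [u]. *)
    rewrite triD //; apply/eqP => Eq.
    * have : sh i%:Z u = sh j%:Z v.
        apply: (in_GT_inj hG); [exact: O | exact: O | ].
        by rewrite h2 ?pE ?Ev ?Eq //; lia.
      rewrite Ev Eq => /(sh_inj OmS aper Ov) [E].
      by move/eqP: H; apply; apply: val_inj; rewrite /= JE.
    * have /negP[] := D_gap Hq (k := j%:Z - i%:Z) ltac:(lia).
      have -> : sh (j%:Z - i%:Z) v = u.
        by rewrite /v Eq JE !shD; have -> : j%:Z - i%:Z - j%:Z + i%:Z = 0 by [lia]; rewrite sh0.
      exact: D_marker Du.
    * have /negP[] := D_gap Du (k := i%:Z - q%:Z) ltac:(rewrite Eq tE; case: ifP => _; lia).
      have -> : sh (i%:Z - q%:Z) u = v by rewrite /v shD addrC.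
      exact: D_marker Hq.
  + by lia.
- move=> m u Hm Ou Du; have [r Hr Er] := h3 m u (ltnW Hm) Ou Du.
  rewrite Er.
  case: (pickP (fun q : 'I_n.+1 => D j (sh (- q%:Z) (sh r%:Z u)))) => [q Hq|Hno]; last first.
    by exists r => //; rewrite tow_out // => q; rewrite Hno.
  set v := sh _ _ in Hq; have Ov : Om v by do 2 apply: O.
  have Ev : sh r%:Z u = sh q%:Z v by rewrite shKV.
  have Hqn := ltn_ord q.
  (* Otherwise one of the markers [u], [v] lies in the gap following the other. *)
  have Erq : r = q.
    case: (ltngtP r q) => // H.
      have /negP[] := D_gap Hq (k := q%:Z - r%:Z) ltac:(lia).
      have -> : sh (q%:Z - r%:Z) v = u.
        by rewrite /v !shD; have -> : q%:Z - r%:Z - q%:Z + r%:Z = 0 by [lia]; rewrite sh0.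
      exact: D_marker Du.
    have /negP[] := D_gap Du (k := r%:Z - q%:Z) ltac:(lia).
    have -> : sh (r%:Z - q%:Z) u = v by rewrite /v shD addrC.
    exact: D_marker Hq.
  have Euv : v = u by rewrite /v Erq shK.
  exists (s u q : nat); first by have := ltn_ord (s u q); lia.
  by rewrite Ev (tow_at OmS sD) // Euv.
Qed.

Lemma sort_upto d : exists2 al, alt Om al & sorted_upto (M.+2 + d) (fun x => al (g x)).
Proof.
elim: d => [|d [al aal Hs]].
  exists id; first exact: gen_id.
  split=> //; first by move=> i u; lia.
  (* The target level is nonnegative because [m] is at least [M.+2] and the displacement at most
     [M]. *)
  move=> m u Hm Ou Du; exists (absz (m%:Z + f (sh m%:Z u))).
    by have := fM (O m%:Z Ou); lia.
  rewrite gE ?shD; last exact: O.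
  by congr (sh _ u); have := fM (O m%:Z Ou); lia.
have [|be abe Hs'] := sort_step _ Hs; first by lia.
exists (fun x => be (al x)); first exact: gen_comp.
by rewrite addnS.
Qed.

(** Every point has a marker at most [N] behind it, so levels below [M.+2 + N] suffice and finitely
    many sorting steps treat all blocks at once. *)
Lemma sort_outside_markers (N : nat) :
  (forall x, Om x -> exists2 k : int, - N%:Z <= k <= 0 & U (sh k x)) ->
  exists al, [/\ alt Om al, in_GT Om (fun x => al (g x)) &
    forall x, Om x -> (forall k : int, - M.+2%:Z < k <= M%:Z -> ~~ U (sh k x)) ->
      al (g x) = x].
Proof.
move=> HN; have [al aal [hG h2 _]] := sort_upto N.
exists al; split=> // x Ox Hx.
have exj : exists j : nat, U (sh (- j%:Z) x).
  have [k Hk Uk] := HN x Ox; exists (absz k); by have -> : - (absz k)%:Z = k by lia.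
(* The nearest marker behind [x]. Minimality excludes markers between it and [x], and the hypothesis
   excludes those up to [M] beyond, so it satisfies [D j]. *)
case: (ex_minnP exj) => j Uj jmin.
have Hj : (M.+2 <= j)%N.
  rewrite leqNgt; apply/negP => Hj; have := Hx (- j%:Z) ltac:(lia).
  by rewrite Uj.
have HjN : (j < M.+2 + N)%N.
  have [k Hk Uk] := HN x Ox; have := jmin (absz k).
  have -> : - (absz k)%:Z = k by lia.
  by move=> /(_ Uk); lia.
have := h2 j (sh (- j%:Z) x); rewrite shKV; apply; [lia | exact: O | ].
rewrite /D Uj; apply/forallP => i; rewrite shD; apply/negP => Ui.
have Hi := ltn_ord i.
case: (leqP i.+1 j) => Hij.
  have E : (i.+1)%:Z - j%:Z = - (j - i.+1)%N%:Z by lia.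
  by rewrite E in Ui; have := jmin _ Ui; lia.
by have := Hx ((i.+1)%:Z - j%:Z) ltac:(lia); rewrite Ui.
Qed.

End Sort.

Lemma alt_inv F : alt Om F -> exists2 G, alt Om G & inverse_on Om F G.
Proof.
elim=> [F' E|g F1 F' [U [lU sU ->]] mg gF [G aG [H1 H2]] E].
  exists id; [exact: gen_id | by split=> x Ox; rewrite E].
have aU : alt Om (gam U).
  by apply: gen_base => //; exists U.
have [gam3 _] := gam_gam OmS sU.
have mG := gen_maps aG; have mF := gen_maps gF.
exists (fun x => G (gam U (gam U x))); first exact: (gen_comp aG (gen_comp aU aU)).
split=> x Ox.
  by rewrite E // gam3 ?H1 //; apply: mF.
by rewrite E ?H2 ?gam3 //; do ?apply: mG; do !apply: Om_tow.
Qed.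

Lemma commutator_alt C : is_commutator Om C -> alt Om C.
Proof.
move=> [g [gi [h [hi [gG hG gI hI EC]]]]].
have [_ [f [_ [lf _ gE _ _]]]] := in_GTE OmC gG.
have [_ [f' [_ [lf' _ hE _ _]]]] := in_GTE OmC hG.
have [M1 HM1] := lc_bounded lf; have [M2 HM2] := lc_bounded lf'.
(* Each support lies within offsets [- M - 1] to [M] of its markers. Two such offsets differ by at
   most [2 * M + 1], less than [c], so with [U] separated by [2 * c + 1] the supports for [U] and
   for its translate by [c] are disjoint. *)
pose M := (M1 + M2)%N; pose c := (2 * M).+2.
have fM x : Om x -> (absz (f x) <= M)%N by move=> /HM1; rewrite /M; lia.
have f'M x : Om x -> (absz (f' x) <= M)%N by move=> /HM2; rewrite /M; lia.
have [U [lU sU HU]] := marker OmS OmC aper (2 * c).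
pose V x := U (sh c%:Z x).
have lV : lc Om V by apply: lc_sh.
have [|al [aal GG Gfix]] := @sort_outside_markers g f M U gG gE fM lU (2 * (2 * c) + c).
  move=> x Ox; have [k Hk Uk] := HU (sh (- (2 * c)%:Z) x) (O _ Ox).
  by exists (k - (2 * c)%:Z); [lia | rewrite -shD].
have [|be [abe HG Hfix]] := @sort_outside_markers h f' M V hG hE f'M lV (2 * (2 * c) + c).
  move=> x Ox; have [k Hk Uk] := HU (sh (- (2 * c)%:Z) x) (O _ Ox).
  exists (k - (2 * c)%:Z - c%:Z); first by lia.
  rewrite /V shD; have -> : c%:Z + (k - (2 * c)%:Z - c%:Z) = k - (2 * c)%:Z by lia.
  by rewrite -shD.
pose g' x := al (g x); pose h' x := be (h x).
have mg' : maps_into Om g' := in_GT_maps GG.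
have mh' : maps_into Om h' := in_GT_maps HG.
have disj x : Om x -> g' x = x \/ h' x = x.
  move=> Ox; case: (pselect (g' x = x)) => [|Hg]; first by left.
  right; apply: Hfix => // k Hk; apply/negP => Uk.
  apply: Hg; apply: Gfix => // l Hl; apply/negP => Ul.
  have := sU _ (O l Ox) Ul (c%:Z + k - l) ltac:(rewrite /c; lia).
  by rewrite shD subrK; move: Uk; rewrite /V shD => ->.
have comm x : Om x -> g' (h' x) = h' (g' x).
  move=> Ox; case: (disj x Ox) => E.
    case: (disj (h' x) (mh' x Ox)) => E'; first by rewrite E E'.
    by move/(in_GT_inj HG (mh' x Ox) Ox): E' => Eh; rewrite Eh E Eh.
  case: (disj (g' x) (mg' x Ox)) => E'; last by rewrite E E'.
  by move/(in_GT_inj GG (mg' x Ox) Ox): E' => Eg; rewrite Eg E Eg.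
have [ai aai aI] := alt_inv aal; have [bi abi bI] := alt_inv abe.
have mal := gen_maps aal; have mbe := gen_maps abe.
have mai := gen_maps aai; have mbi := gen_maps abi.
have mg := in_GT_maps gG; have mh := in_GT_maps hG.
have giG := in_GT_inv OmS OmC gG gI; have hiG := in_GT_inv OmS OmC hG hI.
have mgi := in_GT_maps giG; have mhi := in_GT_maps hiG.
have [gi' _] := gI; have [hi' _] := hI.
have g'I : inverse_on Om g' (fun x => gi (ai x)).
  split=> x Ox; first by rewrite /g' (proj1 aI) ?(proj1 gI) //; apply: mg.
  by rewrite /g' (proj2 gI) ?(proj2 aI) //; apply: mai.
have b1 := alt_conj OmS OmC aper GG g'I abi.
have a2 := alt_conj OmS OmC aper hG hI aal.
(* [g h = K (h g)] with [K = al^-1 (g' be^-1 g'^-1) be (h al h^-1)]. *)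
have aK := gen_comp aai (gen_comp b1 (gen_comp abe a2)).
(* The commutator equals [K] conjugated by [g^-1 h^-1], whose inverse is [h g]. *)
have hgI : inverse_on Om (fun x => gi (hi x)) (fun x => h (g x)).
  split=> x Ox; first by rewrite (proj2 gI) ?(proj2 hI) //; apply: mhi.
  by rewrite (proj1 hI) ?(proj1 gI) //; apply: mg.
apply: gen_ext (alt_conj OmS OmC aper (in_GT_comp OmS OmC giG hiG) hgI aK) => x Ox.
rewrite EC //; congr (gi (hi _)).
have Ogx := mg _ Ox; have Ohx := mh _ Ox.
have Obx : Om (be (h x)) by apply: mbe.
rewrite (proj1 hI) //.
have -> : be (h (al (g x))) = g' (be (h x)) by rewrite [RHS](comm x Ox).
have -> : ai (g' (be (h x))) = g (be (h x)) by rewrite /g' (proj1 aI) //; apply: mg.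
rewrite (proj1 gI) // (proj1 bI) // /g' (proj1 aI) //; exact: mg.
Qed.

Lemma derived_alt F : in_GT' Om F -> alt Om F.
Proof.
move=> [s [Hs E]]; apply: (@gen_ext _ _ _ (compose_all s)); first by move=> x Ox; rewrite E.
elim: s Hs {E} => [|C s IH] Hs; first exact: gen_id.
apply: gen_comp (commutator_alt (Hs 0%N isT)) (IH _) => i Hi.
exact: (Hs i.+1 Hi).
Qed.

End Derived.

(** * Finite generation *)

(** The right-hand side is the commutator of two 3-cycles with the single common point 2, squares
    standing for inverses. *)
Lemma cyc3_comm : cyc3 4 1 =
  (cyc3 4 0 * cyc3 4 2 * cyc3 4 2 * cyc3 4 0 * cyc3 4 0 * cyc3 4 2)%g.
Proof.
apply/permP => i; apply: val_inj.
have E k Hk j := @cyc3E 4 k j Hk.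
move: (E 0 isT) (E 1 isT) (E 2 isT) => /=.
move: (cyc3 4 0) (cyc3 4 1) (cyc3 4 2) => u w v Eu Ew Ev.
rewrite !permM /= Ew.
by case: i => [[|[|[|[|[|//]]]]] Hi]; rewrite !(Eu, Ev).
Qed.

Section Cylinders.
Variable A : finType.
Notation X := (int -> A).
Variable Om : X -> Prop.
Hypotheses (OmS : shift_invariant Om) (OmC : closed_set Om).
Hypothesis aper : forall x k, Om x -> sh k x = x -> k = 0.

Let O k x : Om x -> Om (sh k x).
Proof. by move=> Ox; rewrite (Om_sh OmS). Qed.

Lemma gam_ext (P Q : X -> bool) x : (forall y, Om y -> P y = Q y) -> Om x ->
  gam P x = gam Q x.
Proof.
move=> E Ox; rewrite /gam /tow.
have EE : (fun i : 'I_3 => P (sh (- i%:Z) x)) =1 (fun i => Q (sh (- i%:Z) x)).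
  by move=> i; rewrite E //; apply: O.
by rewrite (eq_pick EE).
Qed.

Lemma gam_at (P : X -> bool) x : sep Om 3 P -> Om x -> P x -> gam P x = sh 1 x.
Proof.
move=> sP Ox Px; rewrite -{1}(sh0 x) (_ : 0 = (ord0 : 'I_3)%:Z) //.
by rewrite /gam (tow_at OmS sP) // cyc3E.
Qed.

Lemma gam_triv (P : X -> bool) : sep Om 3 P ->
  (forall x, Om x -> gam P x = x) <-> (forall x, Om x -> ~~ P x).
Proof.
move=> sP; split=> H x Ox.
  apply/negP => Px; have := H x Ox; rewrite gam_at // => /(aper Ox); lia.
by apply: tow_out => i; apply: H; apply: O.
Qed.

(** On three levels a 3-cycle is the commutator of the two adjacent transpositions, which also act
    as elements of the full group. *)
Lemma gam_derived (P : X -> bool) : lc Om P -> sep Om 3 P -> in_GT' Om (gam P).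
Proof.
move=> lP sP; exists [:: gam P]; split=> // k; rewrite ltnS leqn0 => /eqP ->.
exists (tow P (fun=> adj 2 1)), (tow P (fun=> (adj 2 1)^-1%g)),
  (tow P (fun=> adj 2 0)), (tow P (fun=> (adj 2 0)^-1%g)).
split; try exact: (in_GT_tow OmS sP lP (lc_const _ _)); try exact: (tow_inv OmS sP).
move=> x Ox; rewrite !(towM OmS sP) //; try by do ?apply: Om_tow.
apply: (tow_ext OmS sP) => // _ _ _; rewrite !tpermV.
apply/permP => i; apply: val_inj; rewrite !permM /=.
by rewrite !adjE //; case: i => [[|[|[|//]]] Hi].
Qed.

(* The right-hand side is the commutator [gV gU^-1 gV^-1 gU], written without inverses
   as both elements have order 3. *)
Lemma gam_comm (W QU QV : X -> bool) x : sep Om 5 W -> Om x ->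
  let U y := W y && QU y in let V y := W (sh (- 2) y) && QV (sh (- 2) y) in
  gam (fun y => W (sh (- 1) y) && (QU (sh (- 1) y) && QV (sh (- 1) y))) x =
  gam V (gam U (gam U (gam V (gam V (gam U x))))).
Proof.
move=> sW Ox U V.
have EU y : Om y -> gam U y = tow W (fun u => if QU u then cyc3 4 0 else 1%g) y.
  move=> Oy; rewrite -(gam_embed OmS QU (k := 0) (n := 4) isT sW Oy).
  by apply: gam_ext => // z _; rewrite sh0.
have EV y : Om y -> gam V y = tow W (fun u => if QV u then cyc3 4 2 else 1%g) y.
  by move=> Oy; rewrite -(gam_embed OmS QV (k := 2) (n := 4) isT sW Oy).
have T s y : Om y -> Om (tow (n := 4) W s y) by apply: Om_tow.
rewrite (EU x) //; set y1 := tow _ _ x; have O1 : Om y1 by apply: T.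
rewrite (EV y1) //; set y2 := tow _ _ y1; have O2 : Om y2 by apply: T.
rewrite (EV y2) //; set y3 := tow _ _ y2; have O3 : Om y3 by apply: T.
rewrite (EU y3) //; set y4 := tow _ _ y3; have O4 : Om y4 by apply: T.
rewrite (EU y4) //; set y5 := tow _ _ y4; have O5 : Om y5 by apply: T.
rewrite (EV y5) // /y5 /y4 /y3 /y2 /y1.
rewrite (gam_embed OmS (fun y => QU y && QV y) (k := 1) (n := 4) isT sW Ox).
rewrite !(towM OmS sW) //; try by do ?apply: T.
apply: (tow_ext OmS sW) => // u _ _.
move: (@cyc3_cube 4 0 isT) (@cyc3_cube 4 2 isT) cyc3_comm.
move: (cyc3 4 0) (cyc3 4 1) (cyc3 4 2) => p q r Ep Er Eq.
rewrite !mulgA; case: (QU u); case: (QV u); rewrite /= ?mulg1 ?mul1g //.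
  by rewrite -!mulgA.
by rewrite -!mulgA.
Qed.

Definition cyl (i j : int) (y x : X) : bool :=
  `[< forall m : int, i <= m <= j -> x m = y m >].

Lemma cyl_sh i j k y x : cyl i j y (sh k x) = cyl (i + k) (j + k) (sh (- k) y) x.
Proof.
apply/asboolP/asboolP => H m Hm.
  by have := H (m - k) ltac:(lia); rewrite /sh subrK.
by have := H (m + k) ltac:(lia); rewrite /sh addrK.
Qed.

Lemma cylI i d c j y x : i <= d -> d <= c -> c <= j ->
  cyl d c y x && (cyl i c y x && cyl d j y x) = cyl i j y x.
Proof.
move=> H1 H2 H3; apply/idP/asboolP => [/and3P[_ /asboolP Hi /asboolP Hj] m Hm|H].
  by case: (lerP m c) => Hc; [apply: Hi | apply: Hj]; lia.
apply/and3P; split; apply/asboolP => m Hm; apply: H; lia.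
Qed.

Lemma cylW i d c j y x : i <= d -> c <= j -> cyl i j y x -> cyl d c y x.
Proof. by move=> H1 H2 /asboolP H; apply/asboolP => m Hm; apply: H; lia. Qed.

Lemma cyl_ext i j y y' x : (forall m, i <= m <= j -> y m = y' m) ->
  cyl i j y x = cyl i j y' x.
Proof. by move=> E; apply/asboolP/asboolP => H m Hm; rewrite H ?E. Qed.

Lemma lc_cyl i j y : lc Om (cyl i j y).
Proof.
exists (`|i| + `|j|)%N => x x' _ _ E.
have Ex m : i <= m <= j -> x m = x' m by move=> Hm; apply: E; lia.
by apply/asboolP/asboolP => H m Hm; rewrite -H ?Ex.
Qed.

Variable n : nat.
Hypothesis Hn : forall x, Om x -> forall k : int, 0 < k < 5%:Z -> ~ agree n x (sh k x).

Lemma sep_cyl i j y : i + (2 * n)%:Z <= j -> sep Om 5 (cyl i j y).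
Proof.
move=> Hij x Ox /asboolP Cx k Hk; apply/negP => /asboolP Ck.
apply: (Hn (O (i + n%:Z) Ox) Hk) => m Hm.
have H1 := Cx (m + (i + n%:Z)) ltac:(lia); have H2 := Ck (m + (i + n%:Z)) ltac:(lia).
rewrite /sh in H2 *; rewrite H1 -H2; congr (x _); lia.
Qed.

Lemma sep3_cyl i j y : i + (2 * n)%:Z <= j -> sep Om 3 (cyl i j y).
Proof. by move=> H; apply: (sepW (n := 5)) => //; apply: sep_cyl. Qed.

(** The cylinder on [[i, j]] is the intersection of those on [[i, c]] and [[d, j]]. Their overlap is
    long enough to have five disjoint levels and serves as the middle level of the tower over [W] in
    [gam_comm]; the two factors sit one level below and one above, whence the shifts by one. *)
Lemma cyl_step i j d c y x : i <= d -> d + (2 * n)%:Z <= c -> c <= j -> Om x ->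
  let gU := gam (cyl (i + 1) (c + 1) (sh (- 1) y)) in
  let gV := gam (cyl (d - 1) (j - 1) (sh 1 y)) in
  gam (cyl i j y) x = gV (gU (gU (gV (gV (gU x))))).
Proof.
move=> Hid Hdc Hcj Ox gU gV.
pose W z := cyl d c y (sh 1 z).
have sW : sep Om 5 W by apply: sep_sh => //; apply: sep_cyl.
have M P z : Om z -> Om (gam P z) by move=> Oz; apply: Om_tow.
have S1 z : sh 1 (sh (- 1) z) = z by rewrite shKV.
have S2 z : sh 1 (sh (- 2) z) = sh (- 1) z by rewrite shD.
have EU z : Om z -> gU z = gam (fun z => W z && cyl i c y (sh 1 z)) z.
  apply: gam_ext => v _; rewrite /W -cyl_sh andbC.
  by case: (boolP (cyl i c y (sh 1 v))) => //= H; rewrite (cylW _ _ H).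
have EV z : Om z -> gV z = gam (fun z => W (sh (- 2) z) && cyl d j y (sh 1 (sh (- 2) z))) z.
  apply: gam_ext => v _; rewrite /W S2 andbC.
  have <- : cyl d j y (sh (- 1) v) = cyl (d - 1) (j - 1) (sh 1 y) v by rewrite cyl_sh opprK.
  by case: (boolP (cyl d j y (sh (- 1) v))) => //= H; rewrite (cylW _ _ H).
have O1 : Om (gU x) by apply: M.
have O2 : Om (gV (gU x)) by apply: M.
have O3 : Om (gV (gV (gU x))) by apply: M.
have O4 : Om (gU (gV (gV (gU x)))) by apply: M.
have O5 : Om (gU (gU (gV (gV (gU x))))) by apply: M.
rewrite (EV _ O5) (EU _ O4) (EU _ O3) (EV _ O2) (EV _ O1) (EU _ Ox).
rewrite -(gam_comm (fun z => cyl i c y (sh 1 z)) (fun z => cyl d j y (sh 1 z)) sW Ox).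
apply: gam_ext => // v _; rewrite /W !S1 cylI //; lia.
Qed.

(** With overlap [[- n, n]], the shift in [cyl_step] makes the left factor end at [n + 1] and the
    right factor begin at [- n - 1]. Both ends are thus preserved when cylinders are lengthened, and
    these are the shortest cylinders that occur. *)
Definition base_gam (g : X -> X) := exists y,
  g = gam (cyl (1 - n%:Z) (n%:Z + 1) y) \/ g = gam (cyl (- n%:Z - 1) n%:Z y).

Let gam_maps P : maps_into Om (gam P).
Proof. by move=> x Ox; apply: Om_tow. Qed.

Let gen6 S gU gV F : gen Om S gU -> gen Om S gV ->
  (forall x, Om x -> F x = gV (gU (gU (gV (gV (gU x)))))) -> gen Om S F.
Proof.
move=> HU HV E.
apply: (@gen_ext _ _ _ (fun x => gV (gU (gU (gV (gV (gU x))))))); first by move=> x Ox; rewrite E.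
exact: (gen_comp HV (gen_comp HU (gen_comp HU (gen_comp HV (gen_comp HV HU))))).
Qed.

Lemma gen_cyl_right k y : gen Om base_gam (gam (cyl (1 - n%:Z - k%:Z) (n%:Z + 1) y)).
Proof.
elim: k y => [|k IH] y.
  by rewrite subr0; apply: gen_base; [exists y; left | ].
have H := @cyl_step (1 - n%:Z - k.+1%:Z) (n%:Z + 1) (- n%:Z) n%:Z y _
  ltac:(lia) ltac:(lia) ltac:(lia).
apply: gen6 H.
  by have -> : 1 - n%:Z - k.+1%:Z + 1 = 1 - n%:Z - k%:Z by [lia]; apply: IH.
rewrite addrK; apply: gen_base => //; by exists (sh 1 y); right.
Qed.

Lemma gen_cyl_left k y : gen Om base_gam (gam (cyl (- n%:Z - 1) (n%:Z + k%:Z) y)).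
Proof.
elim: k y => [|k IH] y.
  by rewrite addr0; apply: gen_base; [exists y; right | ].
have H := @cyl_step (- n%:Z - 1) (n%:Z + k.+1%:Z) (- n%:Z) n%:Z y _
  ltac:(lia) ltac:(lia) ltac:(lia).
apply: gen6 H; last first.
  by have -> : n%:Z + k.+1%:Z - 1 = n%:Z + k%:Z by [lia]; apply: IH.
(* The left factor is the cylinder on [[- n, n + 1]], the first lengthening of the other family. *)
have -> : - n%:Z - 1 + 1 = 1 - n%:Z - 1%:Z by lia.
exact: gen_cyl_right.
Qed.

Lemma gen_cyl N y : (n < N)%N -> gen Om base_gam (gam (cyl (- N%:Z) N%:Z y)).
Proof.
move=> HN; have H := @cyl_step (- N%:Z) N%:Z (- n%:Z) n%:Z y _
  ltac:(lia) ltac:(lia) ltac:(lia).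
apply: gen6 H.
  have -> : - N%:Z + 1 = 1 - n%:Z - (N - n)%N%:Z by lia.
  exact: gen_cyl_right.
have -> : N%:Z - 1 = n%:Z + (N - n.+1)%N%:Z by lia.
exact: gen_cyl_left.
Qed.

(** Windows of radius [N] decide membership in [U], so each nonempty piece of [U] cut out by a
    window is a full cylinder. *)
Lemma gen_gam U : lc Om U -> sep Om 3 U -> gen Om base_gam (gam U).
Proof.
move=> [m Hm] sU; pose N := (m + n).+1.
apply: (gen_split OmS sU (phi := win N)) => w.
apply: (@gen_ext _ _ _ (gam (fun u => U u && (win N u == w)))).
  by move=> x Ox; rewrite (tow_restrict OmS sU).
case: (pselect (exists2 x, Om x & U x && (win N x == w))) => [[x Ox /andP[Ux /eqP Hw]]|H].
  have HN : (n < N)%N by rewrite /N; lia.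
  apply: gen_ext (gen_cyl x HN) => z Oz; apply: gam_ext => // v Ov.
  apply/asboolP/andP => [E|[_ /eqP]]; last first.
    by rewrite -Hw => /winP E k Hk; apply: E; lia.
  have E' : agree N v x by move=> k Hk; apply: E; lia.
  split; last by rewrite -Hw; apply/eqP/winP.
  by rewrite (Hm v x) //; apply: agreeW E'; rewrite /N; lia.
apply: gen_id => x Ox; apply: tow_out => i; apply/negP => Hi; apply: H.
by exists (sh (- i%:Z) x) => //; apply: O.
Qed.

Lemma derived_base F : in_GT' Om F -> gen Om base_gam F.
Proof.
move=> /(derived_alt OmS OmC aper); apply: gen_sub => _ [U [lU sU ->]].
exact: gen_gam.
Qed.

Lemma compose_all_cat (s t : seq (X -> X)) x :
  compose_all (s ++ t) x = compose_all s (compose_all t x).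
Proof. by elim: s => //= f s ->. Qed.

Lemma eval_word_cat (S : seq ((X -> X) * (X -> X))) (v w : seq ('I_(size S) * bool)) x :
  eval_word (v ++ w) x = eval_word v (eval_word w x).
Proof. by rewrite /eval_word map_cat compose_all_cat. Qed.

(** A base cylinder depends only on finitely many letters of [y]: [U1] lists those on
    [[1 - n, n + 1]], and [U2] those on [[- n - 1, n]], as a window and one more letter. Words in
    the generators themselves suffice. *)
Lemma derived_fin_gen : exists S, gen_set_GT' Om S.
Proof.
pose W := {ffun 'I_(2 * n).+1 -> A}.
pose U1 (w : W) x := win n (sh 1 x) == w.
pose U2 (wa : W * A) x := (win n x == wa.1) && (x (- n%:Z - 1) == wa.2).
have lU1 w : lc Om (U1 w).
  apply: (lc_map (fun v => v == w) (f := fun x => win n (sh 1 x))).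
  by apply: lc_sh => //; apply: lc_win.
have lU2 wa : lc Om (U2 wa).
  apply: lc_map2; first by apply: (lc_map (fun v => v == wa.1)); apply: lc_win.
  apply: (lc_map (fun b => b == wa.2)); exists n.+1 => x y _ _; apply; lia.
have sw w : sep Om 5 (fun x => win n x == w).
  move=> x Ox /eqP Hw k Hk; apply/eqP => Hwk; apply: (Hn Ox Hk); apply/winP.
  by rewrite Hw.
have sU1 w : sep Om 3 (U1 w).
  exact: (@sepW _ _ 3 5 _ isT (@sep_sh _ _ OmS 5 (fun x => win n x == w) 1 (sw w))).
have sU2 wa : sep Om 3 (U2 wa).
  apply: (sepW (n := 5)) => //; apply: (sep_sub OmS (Q := fun x => win n x == wa.1)) => //.
  by move=> x _ /andP[].
pose I := (W + W * A)%type : finType.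
pose UU (i : I) := match i with inl w => U1 w | inr wa => U2 wa end.
have lUU i : lc Om (UU i) by case: i.
have sUU i : sep Om 3 (UU i) by case: i.
pose S := [seq (gam (UU i), fun x => gam (UU i) (gam (UU i) x)) | i <- enum I].
have sizeS : size S = #|I| by rewrite size_map -cardE.
have SE i (Hi : (enum_rank i < size S)%N) x :
    eval_word [:: (Ordinal Hi, false)] x = gam (UU i) x.
  by rewrite /eval_word /= (nth_map i) -?cardE // nth_enum_rank.
have Hrank (i : I) : (enum_rank i < size S)%N by rewrite sizeS.
exists S; split.
  move=> k Hk; have Hk' : (k < size (enum I))%N by move: Hk; rewrite size_map.
  have i0 : I by case: (enum I) Hk' => // i.
  rewrite (nth_map i0) //=; split; [exact: gam_derived | exact: gam_gam].
move=> F /derived_base; elim=> [F' E|g F1 F' [y Hg] mg gF [w Hw] E].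
  by exists [::] => x Ox; rewrite E.
suff [i Hi] : exists i, forall x, Om x -> g x = gam (UU i) x.
  exists ((Ordinal (Hrank i), false) :: w) => x Ox.
  rewrite -cat1s eval_word_cat SE E // -Hw // Hi //; exact: gen_maps gF _ Ox.
case: Hg => ->.
  exists (inl (win n (sh 1 y))) => x Ox; apply: gam_ext => // v _ /=.
  apply/asboolP/eqP => [H|/winP H m Hm].
    by apply/winP => m Hm; apply: H; lia.
  by have := H (m - 1) ltac:(lia); rewrite /sh subrK.
exists (inr (win n y, y (- n%:Z - 1))) => x Ox; apply: gam_ext => // v _ /=.
apply/asboolP/andP => [H|[/eqP/winP H /eqP H'] m Hm].
  split; last by apply/eqP; apply: H; lia.
  by apply/eqP/winP => m Hm; apply: H; lia.
by case: (eqVneq m (- n%:Z - 1)) => [->//|Hm']; apply: H; lia.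
Qed.

End Cylinders.

(** * The language from the word problem *)

Section LanguageFromWP.
Variable A : finType.
Notation X := (int -> A).
Variable Om : X -> Prop.
Hypotheses (OmS : shift_invariant Om) (OmC : closed_set Om).
Hypothesis aper : forall x k, Om x -> sh k x = x -> k = 0.
Variable x0 : X.
Hypothesis Ox0 : Om x0.

Let O k x : Om x -> Om (sh k x).
Proof. by move=> Ox; rewrite (Om_sh OmS). Qed.

(** Only the values at positions from 0 to [size w - 1] matter; the sequence need not lie in
    [Om]. *)
Definition point_of (w : seq A) : X := fun t => nth (x0 0) w (absz t).

Lemma language_cyl (w : seq A) i : language Om w <->
  exists2 x, Om x & cyl i (i + (size w)%:Z - 1) (sh (- i) (point_of w)) x.
Proof.
split=> [[x Ox [k Ew]]|[x Ox /asboolP H]].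
  exists (sh (k - i) x); first exact: O.
  apply/asboolP => m Hm; rewrite /sh /point_of Ew.
  have Hs : (absz (m - i) < size w)%N by lia.
  by rewrite (nth_map 0%N) ?size_iota // nth_iota //; congr (x _); lia.
exists x => //; exists i; apply: (@eq_from_nth _ (x0 0)) => [|k Hk].
  by rewrite size_map size_iota.
rewrite (nth_map 0%N) ?size_iota // nth_iota // H; last by lia.
by rewrite /sh /point_of; congr nth; lia.
Qed.

Variable S : seq ((X -> X) * (X -> X)).
Hypothesis genS : gen_set_GT' Om S.
Local Notation L := ('I_(size S) * bool)%type.

Lemma recursive_language :
  recursive (fun w : seq L => forall x, Om x -> eval_word w x = x) ->
  recursive (language Om).
Proof.
move=> HWP; have [n Hn] := uniform_aperiodicity OmC aper 5.
pose m := (2 * n).+1.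
have word i j y : i + (2 * n)%:Z <= j ->
    exists w : seq L, forall x, Om x -> eval_word w x = gam (cyl i j y) x.
  move=> Hij; have [w Hw] := genS.2 _ (gam_derived OmS (lc_cyl Om i j y) (sep3_cyl OmS Hn Hij)).
  by exists w => x Ox; rewrite Hw.
have triv i j y : i + (2 * n)%:Z <= j -> (forall x, Om x -> gam (cyl i j y) x = x) <->
    (forall x, Om x -> ~~ cyl i j y x).
  by move=> Hij; apply: (gam_triv OmS aper); apply: (sep3_cyl OmS Hn).
have /choice [B HB] : forall v : seq A, exists e : seq L, forall x, Om x ->
    eval_word e x = gam (cyl (- n%:Z - 1) n%:Z (sh (n%:Z + 1) (point_of v))) x.
  by move=> v; apply: word; lia.
(* Words too short for a separated cylinder are settled by the table: those in the language get a
   word for a fixed nontrivial 3-cycle, the others the empty word. *)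
have /choice [E0 HE0] : forall v : seq A, exists e : seq L, if (size v < m)%N
    then (forall x, Om x -> eval_word e x = x) <-> ~ language Om v
    else forall x, Om x ->
      eval_word e x = gam (cyl (1 - n%:Z) (n%:Z + 1) (sh (n%:Z - 1) (point_of v))) x.
  move=> v; case: (ltnP (size v) m) => _; last by apply: word; lia.
  case: (pselect (language Om v)) => Hv; last by exists [::].
  have [e He] := word (- n%:Z) n%:Z x0 ltac:(lia).
  exists e; split; last by move=> H; case: (H Hv).
  move=> H _; have Hx : forall x, Om x -> gam (cyl (- n%:Z) n%:Z x0) x = x.
    by move=> x Ox; rewrite -He ?H.
  by have /negP[] := (triv (- n%:Z) n%:Z x0 ltac:(lia)).1 Hx x0 Ox0; apply/asboolP.
have M P x : Om x -> Om (gam P x) by move=> Ox; apply: Om_tow.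
(* Cylinders are aligned on the right at [n + 1], so appending a letter shifts them. *)
have grow_gam w k : (m + k <= size w)%N -> forall x, Om x -> eval_word (grow m E0 B w k) x =
    gam (cyl (1 - n%:Z - k%:Z) (n%:Z + 1) (sh (n%:Z - 1 + k%:Z) (point_of w))) x.
  elim: k => [|k IH] Hk x Ox.
    have sw : size (take m w) = m by rewrite size_takel //; move: Hk; rewrite addn0.
    have := HE0 (take m w); rewrite sw ltnn /= => -> //; rewrite subr0 addr0.
    apply: (gam_ext OmS) => // v _; apply: cyl_ext => t Ht.
    by rewrite /sh /point_of nth_take //; rewrite /m; lia.
  have {}IH := IH ltac:(lia).
  rewrite [grow _ _ _ _ _]/= /grow_step !eval_word_cat.
  set b := B _; set e := grow _ _ _ _ _.
  pose y := sh (n%:Z - 1 + k.+1%:Z) (point_of w).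
  have Ee z : Om z -> eval_word e z = gam (cyl (1 - n%:Z - k.+1%:Z + 1) (n%:Z + 1) (sh (- 1) y)) z.
    move=> Oz; rewrite IH // /y shD.
    have -> : 1 - n%:Z - k.+1%:Z + 1 = 1 - n%:Z - k%:Z by lia.
    by have -> : - 1 + (n%:Z - 1 + k.+1%:Z) = n%:Z - 1 + k%:Z by lia.
  have Eb z : Om z -> eval_word b z = gam (cyl (- n%:Z - 1) (n%:Z + 1 - 1) (sh 1 y)) z.
    move=> Oz; rewrite HB // addrK; apply: (gam_ext OmS) => // v _; apply: cyl_ext => t Ht.
    rewrite /y /sh /point_of nth_take ?nth_drop; last by rewrite /m; lia.
    by congr nth; lia.
  have Me z : Om z -> Om (eval_word e z) by move=> Oz; rewrite Ee //; apply: M.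
  have Mb z : Om z -> Om (eval_word b z) by move=> Oz; rewrite Eb //; apply: M.
  have H := @cyl_step _ _ OmS n Hn (1 - n%:Z - k.+1%:Z) (n%:Z + 1) (- n%:Z) n%:Z y x
    ltac:(lia) ltac:(lia) ltac:(lia) Ox.
  rewrite H.
  have O1 := Me _ Ox; have O2 := Mb _ O1; have O3 := Mb _ O2; have O4 := Me _ O3.
  have O5 := Me _ O4.
  by rewrite (Eb _ O5) (Ee _ O4) (Ee _ O3) (Eb _ O2) (Eb _ O1) (Ee _ Ox).
have := @recursive_growth A L m E0 B _ HWP.
congr recursive; apply: funext => w; apply: propext.
case: (ltnP (size w) m) => Hw.
  have -> : (size w - m = 0)%N by lia.
  have := HE0 w; rewrite Hw /= take_oversize => [H|]; last exact: ltnW.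
  by split=> [H1|H1 /H]; [apply: contrapT => /H | ].
have sw := subnKC Hw; move: (size w - m)%N sw => K sw.
rewrite (language_cyl w (1 - n%:Z - K%:Z)) -sw.
have -> : 1 - n%:Z - K%:Z + (m + K)%N%:Z - 1 = n%:Z + 1 by rewrite /m; lia.
have -> : - (1 - n%:Z - K%:Z) = n%:Z - 1 + K%:Z by lia.
have G := grow_gam w K (eq_leq sw).
have T := triv (1 - n%:Z - K%:Z) (n%:Z + 1) (sh (n%:Z - 1 + K%:Z) (point_of w)) ltac:(lia).
split=> [H|[x Ox Cx] H].
  apply: contrapT => H'; apply: H => x Ox; rewrite G //; apply: T.2 => // z Oz.
  by apply/negP => Cz; apply: H'; exists z.
have := T.1 (fun z Oz => eq_trans (esym (G z Oz)) (H z Oz)) x Ox.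
by rewrite Cx.
Qed.
End LanguageFromWP.

(** * The word problem from the language *)

Section WPFromLanguage.
Variable A : finType.
Notation X := (int -> A).
Variable Om : X -> Prop.
Hypotheses (OmS : shift_invariant Om) (OmC : closed_set Om).
Hypothesis aper : forall x k, Om x -> sh k x = x -> k = 0.
Variable x0 : X.

Let O k x : Om x -> Om (sh k x).
Proof. by move=> Ox; rewrite (Om_sh OmS). Qed.

Variable S : seq ((X -> X) * (X -> X)).
Hypothesis GTS : forall k, (k < size S)%N -> in_GT Om (nth (id, id) S k).1 /\
  inverse_on Om (nth (id, id) S k).1 (nth (id, id) S k).2.
Local Notation L := ('I_(size S) * bool)%type.

Definition letter (l : L) : X -> X :=
  if l.2 then (nth (id, id) S (val l.1)).2 else (nth (id, id) S (val l.1)).1.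
Definition letter_inv (l : L) : X -> X := letter (l.1, ~~ l.2).

Lemma letterP l : in_GT Om (letter l) /\ inverse_on Om (letter l) (letter_inv l).
Proof.
case: l => k b; have [H I] := GTS (ltn_ord k); rewrite /letter_inv /letter.
case: b => //=; split; first exact: (in_GT_inv OmS OmC H I).
by case: I.
Qed.

(* Letters are read from the left, so this is the inverse of [eval_word w]. *)
Definition run (w : seq L) x := foldl (fun z l => letter_inv l z) x w.

Lemma run_eval w x : Om x -> Om (run w x) /\ eval_word w (run w x) = x.
Proof.
elim: w x => [//|l w IH] x Ox.
have [H [I1 I2]] := letterP l.
have [O1 E1] := IH (letter_inv l x) (in_GT_maps (in_GT_inv OmS OmC H (conj I1 I2)) Ox).
split=> //; rewrite -[RHS]I2 // -[in RHS]E1.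
by rewrite /eval_word.
Qed.

Definition factor (x : X) (i : int) (l : nat) : seq A := [seq x (i + j%:Z) | j <- iota 0 l].

Lemma size_factor x i l : size (factor x i l) = l.
Proof. by rewrite size_map size_iota. Qed.

Lemma nth_factor a x i l j : (j < l)%N -> nth a (factor x i l) j = x (i + j%:Z).
Proof. by move=> Hj; rewrite (nth_map 0%N) ?size_iota // nth_iota. Qed.

Lemma factor_sh x i k l : factor (sh k x) i l = factor x (i + k) l.
Proof. by apply: eq_map => j; rewrite /sh; congr (x _); lia. Qed.

Lemma factor_agree n x y :
  factor x (- n%:Z) (2 * n).+1 = factor y (- n%:Z) (2 * n).+1 -> agree n x y.
Proof.
move=> E m Hm; have Hk : (absz (m + n%:Z)%R < (2 * n).+1)%N by lia.
have := congr1 (fun s => nth (x 0) s (absz (m + n%:Z))) E.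
by rewrite !nth_factor //; have -> : - n%:Z + (absz (m + n%:Z)%R)%:Z = m by lia.
Qed.

(** The displacement by a letter depends on a window of bounded size, so the action of [w] on a
    point can be followed on a finite factor. By aperiodicity [w] is trivial iff the position always
    returns to its start. *)
Lemma recursive_WP : recursive (language Om) ->
  recursive (fun w : seq L => forall x, Om x -> eval_word w x = x).
Proof.
move=> Hlang.
have /choice [f Hf] : forall l : L, exists f : X -> int,
    lc Om f /\ forall x, Om x -> letter_inv l x = sh (f x) x.
  move=> l; have [H I] := letterP l.
  have [_ [f [_ [lf _ E _ _]]]] := in_GTE OmC (in_GT_inv OmS OmC H I).
  by exists f.
have [n Hn] : exists n, forall l x y, Om x -> Om y -> agree n x y -> f l x = f l y.
  have := @fin_bound L (fun l n => forall x y, Om x -> Om y -> agree n x y -> f l x = f l y).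
  apply=> [l k k' Hk H x y Ox Oy Hxy|l]; last by case: (Hf l) => [[k Hk] _]; exists k.
  by apply: H => //; apply: agreeW Hxy.
have [M HM] : exists M, forall l x, Om x -> (absz (f l x) <= M)%N.
  have := @fin_bound L (fun l M => forall x, Om x -> (absz (f l x) <= M)%N).
  apply=> [l k k' Hk H x Ox|l]; last by apply: lc_bounded; case: (Hf l).
  exact: leq_trans (H x Ox) Hk.
pose W := (2 * n).+1.
(* All points of [Om] showing the factor [s] have the same displacement. Factors that do not occur
   get the value 0, which is never consulted on words of the language. *)
have /choice [mv' Hmv'] : forall ls : L * seq A, exists k : nat, forall x, Om x ->
    ls.2 = factor x (- n%:Z) W -> k%:Z = M%:Z + f ls.1 x.
  move=> [l s]; case: (pselect (exists2 x, Om x & s = factor x (- n%:Z) W)) => [[x Ox Es]|H].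
    exists (absz (M%:Z + f l x)) => y Oy Ey /=.
    rewrite -(Hn l x y) //; first by have := HM l x Ox; lia.
    by apply: factor_agree; rewrite -/W -Es -Ey.
  by exists 0%N => x Ox Ex; case: H; exists x.
pose mv l s := mv' (l, s).
have Hmv l x : Om x -> (mv l (factor x (- n%:Z) W))%:Z = M%:Z + f l x.
  by move=> Ox; apply: (Hmv' (_, _)).
have [a Ha] := @recursive_walk A L W M mv (x0 0) _ Hlang.
(* Position [M * K + d] in the factor stands for the point [sh d x], whose central window begins
   exactly there. The inequality keeps all remaining windows inside the factor. *)
have walkP K x : Om x -> forall w p d, p%:Z = (M * K)%N%:Z + d ->
    (absz d + M * size w <= M * K)%N -> exists2 d' : int,
      (walk W M mv a (factor x (- (n + M * K)%N%:Z) (W + 2 * (M * K))) p w)%:Z = (M * K)%N%:Z + d' &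
      run w (sh d x) = sh d' x.
  move=> Ox; set u := factor _ _ _; elim=> [|l w IH] p d Hp Hd; first by exists d.
  have Hwin : window W a u p = factor (sh d x) (- n%:Z) W.
    apply: (@eq_from_nth _ a); first by rewrite size_mkseq size_factor.
    move=> i; rewrite size_mkseq => Hi; rewrite nth_mkseq // !nth_factor //; last first.
      by rewrite /W in Hi *; lia.
    by rewrite /sh; congr (x _); lia.
  have [_ Hl] := Hf l; have Od := O d Ox; have HMl := HM l _ Od; have Em := Hmv l _ Od.
  have {}Hd : (absz d + (M + M * size w) <= M * K)%N by rewrite -mulnS.
  have [||d' E1 E2] := IH (p + mv l (window W a u p) - M)%N (f l (sh d x) + d).
  - by rewrite Hwin; lia.
  - lia.
  exists d'; first exact: E1.
  by rewrite -E2 -shD -Hl.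
move: Ha; congr recursive; apply: funext => w; apply: propext.
have [K [EK HK]] : exists K, K = pickle w /\ (size w <= K)%N.
  by exists (pickle w); split=> //; apply: size_le_pickle.
rewrite -EK.
have HMK : (absz 0 + M * size w <= M * K)%N by rewrite add0n leq_mul2l HK orbT.
split=> H.
  move=> x Ox; have [d' E1 E2] := walkP K x Ox w (M * K)%N 0 (esym (addr0 _)) HMK.
  have Hu : language Om (factor x (- (n + M * K)%N%:Z) (W + 2 * (M * K))).
    by exists x => //; exists (- (n + M * K)%N%:Z); rewrite size_factor.
  have := H _ (size_factor _ _ _) Hu => Ew; rewrite Ew in E1.
  have d0 : d' = 0 by lia.
  rewrite d0 !sh0 in E2; have [_ E] := run_eval w Ox; by rewrite E2 in E.
move=> u su [x Ox [i Eu]].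
(* Recentres the point so that [u] becomes the factor treated in [walkP]. *)
pose y := sh (i + (n + M * K)%N%:Z) x; have Oy : Om y by apply: O.
have Ey : u = factor y (- (n + M * K)%N%:Z) (W + 2 * (M * K)).
  transitivity (factor x i (size u)); first exact: Eu.
  by rewrite factor_sh su; congr (factor x _ _); lia.
have [d' E1 E2] := walkP K y Oy w (M * K)%N 0 (esym (addr0 _)) HMK.
have [O1 E] := run_eval w Oy; rewrite H // in E.
rewrite sh0 E in E2; have d0 := aper Oy (esym E2).
by rewrite -Ey d0 addr0 in E1; case: E1.
Qed.
End WPFromLanguage.

(** * Periodic subshifts *)

Lemma derived_in_GT (A : finType) (Om : (int -> A) -> Prop) F :
  shift_invariant Om -> closed_set Om -> in_GT' Om F -> in_GT Om F.
Proof.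
move=> OmS OmC [s [Hs E]]; apply: (@in_GT_ext _ _ (compose_all s)) => [x Ox|].
  by rewrite E.
elim: s Hs {E} => [|C s IH] Hs /=.
  have I : inverse_on Om (@id (int -> A)) id by [].
  have E0 x : Om x -> id x = sh 0 x by rewrite sh0.
  exact: (in_GTI OmS (lc_const Om 0) (lc_const Om 0) E0 E0 I).
have CG : in_GT Om C.
  have [g [gi [h [hi [gG hG gI hI EC]]]]] := Hs 0%N isT.
  have giG := in_GT_inv OmS OmC gG gI; have hiG := in_GT_inv OmS OmC hG hI.
  apply: (@in_GT_ext _ _ (fun x => gi (hi (g (h x))))) => [x Ox|].
    by have := EC x Ox.
  exact: (in_GT_comp OmS OmC giG (in_GT_comp OmS OmC hiG (in_GT_comp OmS OmC gG hG))).
apply: (in_GT_comp OmS OmC CG (IH _)) => i Hi; exact: (Hs i.+1 Hi).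
Qed.

Section Periodic.
Variable A : finType.
Notation X := (int -> A).
Variable Om : X -> Prop.
Hypotheses (OmS : shift_invariant Om) (OmC : closed_set Om).
Hypothesis OmM : forall x y, Om x -> Om y -> forall n, exists k : int, agree n (shiftn k x) y.
Variables (x0 : X) (p : nat).
Hypotheses (Ox0 : Om x0) (px0 : sh p.+1%:Z x0 = x0).

Let O k x : Om x -> Om (sh k x).
Proof. by move=> Ox; rewrite (Om_sh OmS). Qed.

Definition pt (i : 'I_p.+1) : X := sh i%:Z x0.

Lemma Om_pt i : Om (pt i).
Proof. exact: O. Qed.

Lemma sh_period (q : int) : sh (q * p.+1%:Z) x0 = x0.
Proof.
have Hn (k : nat) : sh (k%:Z * p.+1%:Z) x0 = x0.
  elim: k => [|k IH]; first by rewrite mul0r sh0.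
  by rewrite intS mulrDl mul1r -shD IH px0.
case: q => k; first exact: Hn.
by rewrite NegzE mulNr -{1}(Hn k.+1) shK.
Qed.

(** A point off the finite orbit would differ from all its points on one common window, against
    density of the orbit. *)
Lemma pt_surj y : Om y -> exists i, pt i = y.
Proof.
move=> Oy; apply: contrapT => H.
have [||N HN] := @fin_bound 'I_p.+1 (fun i n => ~ agree n (pt i) y).
- by move=> i m n Hmn Hm /(agreeW Hmn).
- move=> i; apply: contrapT => Hi; apply: H; exists i; apply: funext => m.
  apply: contrapT => Hm; apply: Hi; exists (absz m) => Ha; apply: Hm; exact: Ha.
have [k Hk] := OmM Ox0 Oy N.
have Hi : (absz (k %% p.+1%:Z)%Z < p.+1)%N.
  by have := ltz_pmod k (d := p.+1%:Z) isT; have := modz_ge0 k (d := p.+1%:Z) isT; lia.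
apply: (HN (Ordinal Hi)); rewrite /pt /=.
have -> : (absz (k %% p.+1%:Z)%Z)%:Z = (k %% p.+1%:Z)%Z.
  by have := modz_ge0 k (d := p.+1%:Z) isT; lia.
by move: Hk; rewrite {1}(divz_eq k p.+1%:Z) addrC -shD sh_period.
Qed.

Lemma pt_map F : maps_into Om F -> exists q : {ffun 'I_p.+1 -> 'I_p.+1},
  forall i, F (pt i) = pt (q i).
Proof.
move=> mF; have /choice [q Hq] : forall i, exists j, F (pt i) = pt j.
  by move=> i; have [j <-] := pt_surj (mF _ (Om_pt i)); exists j.
by exists (finfun q) => i; rewrite ffunE.
Qed.

(** A finite automaton whose state is the set of orbit points still compatible with the letters
    read, each advanced by the shift. *)
Lemma periodic_language : recursive (language Om).
Proof.
have [nxt Hnxt] := @pt_map (sh 1) (fun x => @O 1 x).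
pose step (T : {set 'I_p.+1}) (a : A) := [set nxt i | i in T & pt i 0 == a].
have := @recursive_dfa A {set 'I_p.+1} setT step (fun T => T != set0).
congr recursive; apply: funext => w; apply: propext.
have H T : foldl step T w != set0 <-> exists2 i, i \in T & w = factor (pt i) 0 (size w).
  elim: w T => [|a w IH] T /=.
    split=> [/set0Pn[i Hi]|[i Hi _]]; first by exists i.
    by apply/set0Pn; exists i.
  have E i : factor (pt i) 0 (size w).+1 = pt i 0 :: factor (pt (nxt i)) 0 (size w).
    rewrite -Hnxt factor_sh /factor /= addr0; congr cons.
    by rewrite (iotaDl 1 0) -map_comp; apply: eq_map => j /=; congr (pt i _); lia.
  rewrite IH; split=> [[_ /imsetP[i Hi ->] Ew]|[i Hi]].
    move: Hi; rewrite inE => /andP[Hi /eqP Ha]; exists i => //.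
    by rewrite [factor _ _ _]E Ha -Ew.
  rewrite [factor _ _ _]E => -[Ea Ew]; exists (nxt i) => //.
  by apply: imset_f; rewrite inE Hi Ea eqxx.
rewrite H; split=> [[i _ Ew]|[x Ox [k Ew]]].
  by exists (pt i); [exact: Om_pt | exists 0].
have [i Hi] := pt_surj (O k Ox); exists i; first by rewrite inE.
by rewrite Hi factor_sh add0r.
Qed.

(** Elements of the derived group are determined by their action on the finite orbit. One
    representative is chosen for each self-map that is realised, with the identity elsewhere, and an
    automaton whose state is a self-map evaluates words. *)
Lemma periodic_WP : GT'_solvable_WP Om.
Proof.
pose Q := {ffun 'I_p.+1 -> 'I_p.+1}.
pose acts (F : X -> X) (q : Q) := forall i, F (pt i) = pt (q i).
have /choice [FG HFG] : forall q : Q, exists FG : (X -> X) * (X -> X),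
    [/\ in_GT' Om FG.1, inverse_on Om FG.1 FG.2 &
      forall F, in_GT' Om F -> acts F q -> acts FG.1 q].
  move=> q; case: (pselect (exists F, in_GT' Om F /\ acts F q)) => [[F [HF Hq]]|H].
    have [G [_ [_ [_ _ _ _ I]]]] := in_GTE OmC (derived_in_GT OmS OmC HF).
    by exists (F, G).
  exists (id, id); split=> // [|F HF Hq]; first by exists [::].
  by case: H; exists F.
pose S := [seq FG q | q <- enum {ffun 'I_p.+1 -> 'I_p.+1}].
have sizeS : size S = #|{ffun 'I_p.+1 -> 'I_p.+1}| by rewrite size_map -cardE.
have nthS k : (k < size S)%N -> exists q, nth (id, id) S k = FG q.
  rewrite size_map => Hk; exists (nth [ffun=> ord0] (enum {ffun 'I_p.+1 -> 'I_p.+1}) k).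
  by rewrite (nth_map [ffun=> ord0]).
have HS k : (k < size S)%N -> in_GT' Om (nth (id, id) S k).1 /\
    inverse_on Om (nth (id, id) S k).1 (nth (id, id) S k).2.
  by move=> /nthS [q ->]; case: (HFG q).
exists S; split.
  split=> // F HF; have [q Hq] := pt_map (in_GT_maps (derived_in_GT OmS OmC HF)).
  have Hr : (enum_rank q < size S)%N by rewrite sizeS.
  exists [:: (Ordinal Hr, false)] => x Ox; have [i <-] := pt_surj Ox.
  rewrite /eval_word /= (nth_map q) -?cardE // nth_enum_rank Hq.
  by have [_ _ H] := HFG q; rewrite (H F HF Hq).
pose L := ('I_(size S) * bool)%type.
have GTS k : (k < size S)%N -> in_GT Om (nth (id, id) S k).1 /\
    inverse_on Om (nth (id, id) S k).1 (nth (id, id) S k).2.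
  by move=> /HS [H I]; split=> //; apply: derived_in_GT.
have /choice [act Hact] : forall l : L, exists q : Q, acts (letter l) q.
  by move=> l; apply: pt_map; have [H _] := letterP OmS OmC GTS l; apply: in_GT_maps H.
pose step (q : Q) (l : L) : Q := [ffun i => q (act l i)].
have := @recursive_dfa L Q [ffun i => i] step (fun q => `[< forall i, pt (q i) = pt i >]).
congr recursive; apply: funext => w; apply: propext.
have H G q : acts G q -> forall i, G (eval_word w (pt i)) = pt (foldl step q w i).
  elim: w G q => [|l w IH] G q Hq i /=; first exact: Hq.
  rewrite -(IH (fun x => G (letter l x)) (step q l)) // => j.
  by rewrite ffunE Hact Hq.
have Hid i : eval_word w (pt i) = pt (foldl step [ffun i => i] w i).
  by apply: (H id) => j; rewrite ffunE.
split=> [/asboolP Hw x Ox|Hw].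
  by have [i <-] := pt_surj Ox; rewrite Hid Hw.
by apply/asboolP => i; rewrite -Hid Hw //; apply: Om_pt.
Qed.
End Periodic.

Theorem theorem4p7 (A : finType) (Om : (int -> A) -> Prop) :
  minimal_subshift Om ->
  (recursive (language Om) <-> GT'_solvable_WP Om).
Proof.
move=> [[x0 Ox0] OmC OmS OmM].
case: (pselect (forall x k, Om x -> sh k x = x -> k = 0)) => [aper|H]; last first.
  have [x [k [Ox Ek k0]]] : exists x k, [/\ Om x, sh k x = x & k <> 0].
    apply: contrapT => H'; apply: H => x k Ox Ek; apply: contrapT => k0.
    by apply: H'; exists x, k.
  (* A nonzero period of either sign is brought to the positive form [p.+1] used for the finite
     orbit. *)
  have E : sh (absz k).-1.+1%:Z x = x.
    case: (lerP 0 k) => Hk.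
      by have -> : (absz k).-1.+1%:Z = k by lia.
    have -> : (absz k).-1.+1%:Z = - k by lia.
    by rewrite -{1}Ek shK.
  split=> _; first exact: (periodic_WP OmS OmC OmM Ox E).
  exact: (periodic_language OmS OmM Ox E).
split=> [Hlang|[S [genS HWP]]]; last exact: (recursive_language OmS OmC aper Ox0 genS HWP).
have [n Hn] := uniform_aperiodicity OmC aper 5.
have [S genS] := derived_fin_gen OmS OmC aper Hn.
exists S; split=> //; apply: recursive_WP => // k Hk.
by have [H I] := genS.1 k Hk; split=> //; apply: derived_in_GT.
Qed.
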